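(* Let $Y$ be a stratifiable space and let $X$ be a closed subspace of $Y$ with $|X|\ge 2$. Then there exists a positive linear extension operator $T:\mathbb{R}^{X\times X}\to\mathbb{R}^{Y\times Y}$ that preserves constant functions, bounded functions, continuous functions, pseudometrics, and metrics, and that is continuous with respect to each of the following three topologies (taken simultaneously on the domain and on the range): the topology of point-wise convergence, the uniform topology, and the compact-open topology.
   Context: A $T_1$ topological space $Y$ is stratifiable if to each open $U\subset Y$ one can assign a sequence $(U_n)_{n\in\mathbb{N}}$ of open subsets of $Y$ such that $\overline{U_n}\subset U$ for all $n$, $\bigcup_n U_n=U$, and $U_n\subset V_n$ for all $n$ whenever $U\subset V$ are open. For a space $Z$, $\mathbb{R}^Z$ is the linear space of all (not necessarily continuous) real-valued functions on $Z$. The topology of point-wise convergence is the Tychonoff product topology; the uniform topology is that of uniform convergence on $Z$; the compact-open topology on $\mathbb{R}^Z$ is understood as the topology of uniform convergence on compact subsets of $Z$. An operator $T:\mathbb{R}^{X\times X}\to\mathbb{R}^{Y\times Y}$ is positive if $T(p)\ge 0$ whenever $p\ge0$, and is an extension operator if $T(p)|_{X\times X}=p$ for all $p$. ''$T$ preserves'' a class of functions (constant functions, bounded functions, continuous functions, pseudometrics, metrics) means that $T$ carries every function on $X\times X$ of this class to a function on $Y\times Y$ of the same class; a constant function is carried to the constant function with the same value. Metrics and pseudometrics are understood as functions on $X\times X$ or $Y\times Y$ satisfying the usual axioms; they are not assumed to be continuous or related to the topology. *)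

(* Defs.v *)
From HB Require Import structures.
From mathcomp Require Import all_boot all_order all_algebra.
From mathcomp Require Import all_classical all_reals all_analysis.

Set Implicit Arguments.
Unset Strict Implicit.
Unset Printing Implicit Defensive.

Import Order.TTheory GRing.Theory Num.Theory.
Import numFieldNormedType.Exports.

Local Open Scope classical_set_scope.
Local Open Scope ring_scope.

(* The stratification S assigns (S U n)_n to every open U; its values on
   non-open sets are irrelevant. *)
Definition stratifiable (Y : topologicalType) : Prop :=
  accessible_space Y /\
  exists S : set Y -> nat -> set Y,
    [/\ forall U, open U -> forall n, open (S U n),
        forall U, open U -> forall n, closure (S U n) `<=` U,
        forall U, open U -> \bigcup_n S U n = U
      & forall U V, open U -> open V -> U `<=` V ->
          forall n, S U n `<=` S V n].

Definition is_pseudometric (R : realType) (Z : Type) (d : Z * Z -> R) : Prop :=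
  [/\ forall x y, 0 <= d (x, y),
      forall x, d (x, x) = 0,
      forall x y, d (x, y) = d (y, x)
    & forall x y z, d (x, z) <= d (x, y) + d (y, z)].

Definition is_metric (R : realType) (Z : Type) (d : Z * Z -> R) : Prop :=
  is_pseudometric d /\ forall x y, d (x, y) = 0 -> x = y.

Definition positive_operator (R : realType) (A B : Type)
    (T : (A -> R) -> (B -> R)) : Prop :=
  forall p, (forall a, 0 <= p a) -> forall b, 0 <= T p b.

Definition extension_operator (R : realType) (Y : Type) (X : set Y)
    (T : (X * X -> R) -> (Y * Y -> R)) : Prop :=
  forall p (x y : X), T p (set_val x, set_val y) = p (x, y).

Definition preserves_constants (R : realType) (A B : Type)
    (T : (A -> R) -> (B -> R)) : Prop :=
  forall c : R, T (cst c) = cst c.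

Definition preserves (R : realType) (A B : Type)
    (P : set (A -> R)) (Q : set (B -> R)) (T : (A -> R) -> (B -> R)) : Prop :=
  forall p, P p -> Q (T p).

(* Main.v *)
Require Import Defs.
From HB Require Import structures.
From mathcomp Require Import all_boot all_order all_algebra.
From mathcomp Require Import all_classical all_reals all_analysis.
From mathcomp Require Import wochoice.
From mathcomp Require Import ring lra.

Set Implicit Arguments.
Unset Strict Implicit.
Unset Printing Implicit Defensive.

Import Order.TTheory GRing.Theory Num.Theory.
Import numFieldNormedType.Exports.

Local Open Scope classical_set_scope.
Local Open Scope ring_scope.

(** The operator is an average over random retractions.  To every point y of Y
    and every time t in [0, 1] a value E y t is attached: a point of X, or a
    value None standing for y itself, seen as a new point.  For y in X the value
    is always y; outside X it is new exactly on a final interval of times, whose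
    length v y vanishes at X.  Given p on X * X, let
<<
      T p (y, y') = mean over t of  kernel p (E y t) (E y' t),
>>
    where kernel extends p to the new points.  Each E y takes finitely many
    values, so the mean is a finite linear combination of values of p: T is
    linear, positive, continuous for pointwise and uniform convergence, and any
    inequality valid for the kernel at each time survives averaging.

    The kernel is determined by two distinct points a, b of X and a continuous
    metric m <= 1 on Y.  A point x of X is compared with a new point by the mean
    of p (x, a) and p (x, b), and two new points y, y' with m (y, y') * p (a, b)
    when p is a pseudometric.  As m <= 1 the triangle inequality persists
    ([kernel_triangle]); as a and b differ, a metric stays positive on distinct
    arguments, and the final interval of times has positive length
    ([average_metric]).  The points outside X are told apart by m alone, since
    the values in X may coincide at all times.

    Continuity of T p for continuous p needs y |-> E y to be continuous in
    measure and locally finite up to small displacements (last clause of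
    [random_retraction]).  The same clause shows that the values taken over a
    compact set form a compact set ([carrier_compact]), which gives continuity
    for the compact-open topology.

    The topology enters through two facts on a stratified space.  First, every
    family of open sets has a sigma-disjoint open refinement
    ([sigma_disjoint_refinement]), and each open set is a cozero set; for the
    covers by the neighbourhoods [gnbhs k x], hedgehog pseudometrics on the
    members of the refinements combine into the metric m.  Second, the complement
    of X has a cover by sets U w with centres a w in X such that any U w reaching
    close to a point x of X has its centre close to x ([controlled_cover]).
    Refining this cover gives functions f n and locally constant maps c n from
    the sets where f n does not vanish to X, and E y t is c n y for the first n
    at which f n y is large compared with v y, by a factor depending on t.  The
    choice of the first n replaces a partition of unity: some index N always
    qualifies, at y and at the points near y, so the later ones play no part
    and local finiteness is automatic. *)

(** * Stratifications and point neighbourhoods *)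

Lemma well_order_le (I : choiceType) : exists le : rel I,
  [/\ antisymmetric le, transitive le, total le
    & forall A : set I, A !=set0 -> exists2 i, A i & forall j, A j -> le i j].
Proof.
have [le wo] := well_ordering_principle I.
have min (A : set I) : A !=set0 -> exists2 i, A i & forall j, A j -> le i j.
  move=> [x Ax]; have [|i [[Ai lei] _]] := wo [pred k | `[< A k >]].
    by exists x; apply/asboolP.
  exists i; first exact/asboolP.
  by move=> j Aj; apply: lei; apply/asboolP.
have lexx : reflexive le.
  by move=> k; have [|i -> /(_ k)] := min [set k]; [exists k|exact].
have anti : antisymmetric le.
  move=> i j /andP[ij ji]; have [|z [_ uz]] := wo [pred k | (k == i) || (k == j)].
    by exists i; rewrite inE eqxx.
  have zi : z = i.
    by apply: uz; split; rewrite ?inE ?eqxx// => k; rewrite inE => /orP[]/eqP ->.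
  rewrite -zi; apply: uz; split; rewrite ?inE ?eqxx ?orbT// => k.
  by rewrite inE => /orP[]/eqP ->.
exists le; split => //.
- move=> j i k ij jk; have [|m Am lem] := min [set i; j; k]; first by exists i; do 2 left.
  have mi := lem i (or_introl (or_introl erefl)).
  have mj := lem j (or_introl (or_intror erefl)).
  have mk := lem k (or_intror erefl).
  case: Am => [[]|] /= mE; rewrite mE in mi mj mk; first by [].
    by rewrite (anti i j) ?ij.
  by rewrite -(anti j k) ?jk.
- move=> i j; have [|m [] -> lem] := min [set i; j]; first by exists i; left.
    by rewrite lem //; right.
  by rewrite orbC lem //; left.
Qed.

(** Monotonicity in [n] costs nothing, as closures commute with finite unions, and
    allows two indices to be compared by taking the larger. *)
Definition stratification (Y : topologicalType) (S : set Y -> nat -> set Y) :=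
  [/\ forall U n, open U -> open (S U n),
      forall U n, open U -> closure (S U n) `<=` U,
      forall U x, open U -> U x -> exists n, S U n x,
      forall U V n, open U -> open V -> U `<=` V -> S U n `<=` S V n
    & forall U m n, (m <= n)%N -> S U m `<=` S U n].

Lemma stratifiable_stratification (Y : topologicalType) :
  stratifiable Y -> exists S : set Y -> nat -> set Y, stratification S.
Proof.
move=> [_ [S [oS cS bS mS]]].
exists (fun U => fix s n := if n is k.+1 then s k `|` S U k.+1 else S U 0).
split.
- by move=> U n oU; elim: n => [|n IH]; [exact: oS|apply: openU => //; exact: oS].
- move=> U n oU; elim: n => [|n IH]; first exact: cS.
  by rewrite closureU => x [/IH//|/cS]; exact.
- move=> U x oU; rewrite -{1}(bS _ oU) => -[[|n] _ Snx]; first by exists 0.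
  by exists n.+1; right.
- move=> U V n oU oV UV; elim: n => [|n IH]; first exact: mS.
  by move=> x [/IH|/(mS _ _ oU oV UV)]; [left|right].
- move=> U m n /subnK <-; elim: (n - m)%N => [//|k IH] x /IH.
  by rewrite addSn; left.
Qed.

Section stratified.
Context (Y : topologicalType) (T1Y : accessible_space Y).
Context (S : set Y -> nat -> set Y) (stratS : stratification S).

Let oS U n : open U -> open (S U n). Proof. by case: stratS => + _ _ _ _; apply. Qed.
Let cS U n : open U -> closure (S U n) `<=` U.
Proof. by case: stratS => _ + _ _ _; apply. Qed.
Let exS U x : open U -> U x -> exists n, S U n x.
Proof. by case: stratS => _ _ + _ _; apply. Qed.
Let mS U V n : open U -> open V -> U `<=` V -> S U n `<=` S V n.
Proof. by case: stratS => _ _ _ + _; apply. Qed.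
Let nS U m n : (m <= n)%N -> S U m `<=` S U n.
Proof. by case: stratS => _ _ _ _; apply. Qed.

(** The sequence of neighbourhoods of a point in the characterization of stratifiable
    spaces by Heath: a point outside a closed set has a neighbourhood [S U n]
    disjoint from [gnbhs n x] for all [x] in that set ([gnbhs_disjoint]). *)
Definition gnbhs (n : nat) (x : Y) : set Y := ~` closure (S (~` [set x]) n).

Lemma open_setC1 (x : Y) : open (~` [set x]).
Proof. by apply: closed_openC; exact: accessible_closed_set1. Qed.

Lemma open_gnbhs n x : open (gnbhs n x).
Proof. by apply: closed_openC; exact: closed_closure. Qed.

Lemma gnbhs_self n x : gnbhs n x x.
Proof. by move=> /(cS (open_setC1 x)) /=; apply. Qed.

Lemma gnbhs_anti m n x : (m <= n)%N -> gnbhs n x `<=` gnbhs m x.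
Proof. by move=> mn y + cy; apply; move: y cy; apply: closure_subset; exact: nS. Qed.

(** [U] is contained in the complement of [x], so [S U n] is contained in the set
    whose closure [gnbhs n x] avoids. *)
Lemma gnbhs_disjoint U n x z : open U -> ~ U x -> S U n z -> ~ gnbhs n x z.
Proof.
move=> oU Ux Sz; apply; apply: subset_closure; apply: mS Sz => //.
  exact: open_setC1.
by move=> y Uy /= yx; apply: Ux; rewrite -yx.
Qed.

(** Monotone normality: whichever of the two indices is larger, [gnbhs_disjoint]
    applies at that index. *)
Lemma stratified_sep (U V : set Y) x y m n z : open U -> open V ->
  ~ U y -> ~ V x -> S U m z -> gnbhs m x z -> S V n z -> gnbhs n y z -> False.
Proof.
move=> oU oV Uy Vx SUz gx SVz gy.
have [mn|/ltnW nm] := leqP m n.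
  by apply: (gnbhs_disjoint oU Uy _ gy); exact: nS SUz.
by apply: (gnbhs_disjoint oV Vx _ gx); exact: nS SVz.
Qed.

Lemma stratified_normal (R : realType) : normal_space Y.
Proof.
apply/(@normal_openP R) => A B cA cB AB0.
have nB x : A x -> (~` B) x by move=> Ax Bx; have : (A `&` B) x by []; rewrite AB0.
have nA x : B x -> (~` A) x by move=> Bx Ax; have : (A `&` B) x by []; rewrite AB0.
have oA := closed_openC cA; have oB := closed_openC cB.
exists (\bigcup_(k in [set p : nat * Y | A p.2]) (S (~` B) k.1 `&` gnbhs k.1 k.2)).
exists (\bigcup_(k in [set p : nat * Y | B p.2]) (S (~` A) k.1 `&` gnbhs k.1 k.2)).
split.
- by apply: bigcup_open => k _; apply: openI; [exact: oS|exact: open_gnbhs].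
- by apply: bigcup_open => k _; apply: openI; [exact: oS|exact: open_gnbhs].
- move=> x Ax; have [n Sn] := exS oB (nB _ Ax).
  by exists (n, x) => //; split => //; exact: gnbhs_self.
- move=> x Bx; have [n Sn] := exS oA (nA _ Bx).
  by exists (n, x) => //; split => //; exact: gnbhs_self.
- rewrite -subset0 => z [[[m x] /= Ax [Sz gz]] [[n y] /= By [Sz' gz']]].
  by apply: (@stratified_sep (~` B) (~` A) x y m n z).
Qed.

(** Well-order the indices and let [H i] be the union of the members up to [i].  A
    point whose first member is [j > i] lies outside [H i], so its neighbourhood
    [gnbhs n y] avoids [S (H i) n].  Hence, for fixed [n], the neighbourhoods
    within [S (H i) n] of the points with first member [i] are disjoint from those
    of the points with first member [j]. *)
Lemma sigma_disjoint_refinement (I : choiceType) (D : set I) (U : I -> set Y) :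
  (forall i, D i -> open (U i)) ->
  exists O : nat -> I -> set Y,
    [/\ forall n i, D i -> open (O n i),
        forall n i, D i -> O n i `<=` U i,
        forall n i j y, D i -> D j -> O n i y -> O n j y -> i = j
      & forall y i, D i -> U i y -> exists n, exists2 j, D j & O n j y].
Proof.
move=> oU; have [le [anti trans total minle]] := well_order_le I.
pose H i := \bigcup_(j in [set j | D j /\ le j i]) U j.
have oH i : open (H i) by apply: bigcup_open => j [/oU].
pose P n i := [set y | S (H i) n y /\ forall j, D j -> U j y -> le i j].
pose O n i := \bigcup_(y in P n i) (S (H i) n `&` gnbhs n y `&` U i).
have disj n i j y : le i j -> O n i y -> O n j y -> i = j.
  move=> ij [p _ [[SHy _] _]] [q [_ leq] [[_ gy] _]].
  have [[k [Dk ki] Ukq]|Hq] := pselect (H i q).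
    by apply: anti; rewrite ij (trans k) // leq.
  by case: (gnbhs_disjoint (oH i) Hq SHy gy).
exists O; split.
- move=> n i Di; apply: bigcup_open => y _; apply: openI; last exact: oU.
  by apply: openI; [exact: oS|exact: open_gnbhs].
- by move=> n i Di y [z _ [_]].
- move=> n i j y Di Dj Oi Oj; have /orP[ij|ji] := total i j.
    exact: disj ij Oi Oj.
  exact/esym/(disj _ _ _ _ ji Oj Oi).
move=> y i Di Uiy.
have [|k [Dk Uk] lek] := minle [set k | D k /\ U k y]; first by exists i.
have [n Sn] : exists n, S (H k) n y.
  by apply: exS => //; exists k => //; split => //; exact: lek.
exists n, k => //; exists y; last by split => //; split => //; exact: gnbhs_self.
by split => // j Dj Uj; exact: lek.
Qed.

End stratified.

(** * Weighted suprema of sequences of functions *)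

Section weighted_sup.
Context (R : realType).

Definition unit_valued (T : Type) (f : T -> R) := forall x, 0 <= f x <= 1.

(** Weighted by powers of [2] as a series would be.  With a supremum, however, some term
    exceeds any given bound below the value ([lt_wsup]), and the triangle inequality
    passes through term by term. *)
Definition wsup (T : Type) (f : nat -> T -> R) (x : T) : R :=
  sup (range (fun n => f n x / 2 ^+ n)).

Section basic.
Context (T : Type) (f : nat -> T -> R) (f01 : forall n, unit_valued (f n)).

Let le1 n x : f n x / 2 ^+ n <= 1.
Proof.
have /andP[f0 f1] := f01 n x; rewrite ler_pdivrMr ?exprn_gt0// mul1r.
by apply: (le_trans f1); rewrite exprn_ege1// ler1n.
Qed.

Let hs x : has_sup (range (fun n => f n x / 2 ^+ n)).
Proof. by split; [exists (f 0 x / 2 ^+ 0), 0|exists 1 => _ [n _ <-]]. Qed.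

Lemma wsup_ge n x : f n x / 2 ^+ n <= wsup f x.
Proof. by apply: ub_le_sup; [case: (hs x)|exists n]. Qed.

Lemma wsup_le x c : (forall n, f n x / 2 ^+ n <= c) -> wsup f x <= c.
Proof.
move=> fc; apply: ge_sup; first by case: (hs x).
by move=> _ [n _ <-].
Qed.

Lemma lt_wsup x c : c < wsup f x -> exists n, c < f n x / 2 ^+ n.
Proof.
move=> cx; apply: contrapT => /forallNP nc.
suff : wsup f x <= c by rewrite leNgt cx.
by apply: wsup_le => n; rewrite leNgt; exact/negP.
Qed.

Lemma wsup_unit_valued : unit_valued (wsup f).
Proof.
move=> x; rewrite wsup_le ?andbT//; apply: le_trans (wsup_ge 0 x).
by rewrite divr_ge0 ?exprn_ge0//; case/andP: (f01 0 x).
Qed.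

Lemma wsup_eq0 x : wsup f x = 0 <-> forall n, f n x = 0.
Proof.
split=> [w0 n|f0].
  have := wsup_ge n x; rewrite w0 pmulr_lle0 ?invr_gt0 ?exprn_gt0// => fn0.
  by apply/eqP; rewrite eq_le fn0; case/andP: (f01 n x).
apply/eqP; rewrite eq_le; have /andP[-> _] := wsup_unit_valued x.
by rewrite andbT wsup_le// => n; rewrite f0 mul0r.
Qed.

End basic.

(** From below one term suffices; from above the terms of index at least [N] are
    uniformly small, and finitely many remain. *)
Lemma wsup_continuous (T : topologicalType) (f : nat -> T -> R) :
  (forall n, unit_valued (f n)) -> (forall n, continuous (f n)) ->
  continuous (wsup f).
Proof.
move=> f01 cf x; apply/cvgrPdist_lt => e e0.
have cfn n : (fun y => f n y / 2 ^+ n) @ x --> f n x / 2 ^+ n.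
  by apply: cvgM; [exact: cf|exact: cvg_cst].
have [n fn] : exists n, wsup f x - e < f n x / 2 ^+ n.
  by apply: lt_wsup => //; rewrite ltrBlDr ltrDl.
have [N _ Ne] := near_infty_natSinv_expn_lt (PosNum (divr_gt0 e0 (ltr0Sn R 1))).
have near1 : \forall y \near x, wsup f x - e < f n y / 2 ^+ n.
  by apply: (cvgr_gt (f n x / 2 ^+ n)) => //; exact: cfn.
have near2 : \forall y \near x, forall i : 'I_N,
    f i y / 2 ^+ i < wsup f x + e / 2.
  apply: filter_forall => i; apply: (cvgr_lt (f i x / 2 ^+ i)); first exact: cfn.
  by apply: (le_lt_trans (wsup_ge f01 i x)); rewrite ltrDl divr_gt0.
near=> y; rewrite ltr_distlC; apply/andP; split.
  have := wsup_ge f01 n y; apply: lt_le_trans.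
  by near: y.
apply: (@le_lt_trans _ _ (wsup f x + e / 2)); last first.
  by rewrite ltrD2l ltr_pdivrMr// ltr_pMr// ltr1n.
have fy : forall i : 'I_N, f i y / 2 ^+ i < wsup f x + e / 2 by near: y.
apply: wsup_le => // k; have [kN|Nk] := ltnP k N; first exact/ltW/(fy (Ordinal kN)).
apply: (@le_trans _ _ (e / 2)); last first.
  by rewrite lerDr; case/andP: (wsup_unit_valued f01 x).
apply: ltW; apply: le_lt_trans (Ne k Nk); rewrite ler_pM2r ?invr_gt0 ?exprn_gt0//.
by case/andP: (f01 k y).
Unshelve. all: by end_near. Qed.

Lemma wsup_pseudometric (Z : Type) (d : nat -> Z * Z -> R) :
  (forall n, unit_valued (d n)) -> (forall n, is_pseudometric (d n)) ->
  is_pseudometric (wsup d).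
Proof.
move=> d01 pd; split.
- by move=> x y; case/andP: (wsup_unit_valued d01 (x, y)).
- by move=> x; apply/wsup_eq0 => // n; case: (pd n).
- move=> x y; congr sup; apply: eq_imagel => n _; congr (_ / _).
  by case: (pd n).
- move=> x y z; apply: wsup_le => // n; case: (pd n) => _ _ _ tri.
  apply: le_trans (lerD (wsup_ge d01 n (x, y)) (wsup_ge d01 n (y, z))).
  by rewrite -mulrDl ler_pM2r ?invr_gt0 ?exprn_gt0.
Qed.

End weighted_sup.

(** * Cozero sets and hedgehog pseudometrics *)

(** Weighted supremum of Urysohn functions for the pairs formed by the closure of
    [S O n] and the complement of [O]. *)
Lemma stratified_cozero (R : realType) (Y : topologicalType)
    (S : set Y -> nat -> set Y) (O : set Y) :
  accessible_space Y -> stratification S -> open O ->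
  exists f : Y -> R,
    [/\ unit_valued f, continuous f & forall y, O y <-> f y != 0].
Proof.
move=> T1Y stratS oO; have [oS cS exS _ _] := stratS.
have ury n : exists f : Y -> R,
    [/\ continuous f, [set f x | x in ~` O] `<=` [set 0],
        [set f x | x in closure (S O n)] `<=` [set 1] & range f `<=` `[0, 1]].
  apply: urysohn_ext_itv => //.
  - exact: (stratified_normal T1Y stratS R).
  - exact: open_closedC.
  - exact: closed_closure.
  - by rewrite -subset0 => y [nOy /(cS _ _ oO)].
have [f fP] := choice ury.
have f01 n : unit_valued (f n).
  by move=> y; have [_ _ _ /(_ (f n y))] := fP n; rewrite /= in_itv; apply; exists y.
exists (wsup f); split.
- exact: wsup_unit_valued.
- by apply: wsup_continuous => // n; case: (fP n).
move=> y; split=> [Oy|/eqP fy].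
  have [n Sy] := exS _ _ oO Oy; apply/eqP => /(wsup_eq0 f01)/(_ n) fn0.
  have [_ _ + _] := fP n => /(_ (f n y)); rewrite fn0 => /(_ _)/esym/eqP.
  rewrite oner_eq0 => H; suff : false by []; apply: H.
  by exists y => //; exact: subset_closure.
apply: contrapT => nOy; apply: fy; apply/(wsup_eq0 f01) => n.
by have [_ + _ _] := fP n; apply; exists y.
Qed.

Section hedgehog.
Context (R : realType) (Y : topologicalType) (I : Type).
Context (D : set I) (O : I -> set Y) (f : Y -> R).
Hypotheses (oO : forall i, D i -> open (O i)).
Hypothesis disjO : forall i j y, D i -> D j -> O i y -> O j y -> i = j.
Hypotheses (f01 : unit_valued f) (cf : continuous f).
Hypothesis fO : forall y, f y != 0 -> exists2 i, D i & O i y.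

Let same (p : Y * Y) := exists i, [/\ D i, O i p.1 & O i p.2].

(** The pull-back of the metric of a hedgehog whose spines are indexed by [I]: [y] in
    [O i] is sent to height [f y] on the spine [i], all other points to the centre.
    The factor [1/2] keeps the values in [[0, 1]]. *)
Definition hedgehog (p : Y * Y) : R :=
  (if `[< same p >] then `|f p.1 - f p.2| else f p.1 + f p.2) / 2.

Let f0 y : 0 <= f y. Proof. by case/andP: (f01 y). Qed.
Let f1 y : f y <= 1. Proof. by case/andP: (f01 y). Qed.

Lemma hedgehog_unit_valued : unit_valued hedgehog.
Proof.
move=> [y z]; rewrite /hedgehog /=.
have := f0 y; have := f0 z; have := f1 y; have := f1 z.
case: ifP => _ *; last lra.
have : `|f y - f z| <= 1 by rewrite ler_norml; lra.
by have := normr_ge0 (f y - f z); lra.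
Qed.

Let same_sym y z : same (y, z) -> same (z, y).
Proof. by move=> [i [? ? ?]]; exists i. Qed.

Let same_trans x y z : same (x, y) -> same (y, z) -> same (x, z).
Proof.
move=> [i [Di Ox Oy]] [j [Dj Oy' Oz]]; exists i; split=> //=.
by rewrite (disjO Di Dj Oy Oy').
Qed.

Lemma hedgehog_pseudometric : is_pseudometric hedgehog.
Proof.
split.
- by move=> y z; case/andP: (hedgehog_unit_valued (y, z)).
- move=> y; rewrite /hedgehog /=; case: asboolP => [_|ns].
    by rewrite subrr normr0 mul0r.
  have [->|/fO [i Di Oi]] := eqVneq (f y) 0; first by rewrite addr0 mul0r.
  by case: ns; exists i.
- move=> y z; rewrite /hedgehog /= distrC (addrC (f y)).
  suff -> : `[< same (y, z) >] = `[< same (z, y) >] by [].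
  by apply/idP/idP => /asboolP/same_sym/asboolP.
- move=> x y z; rewrite /hedgehog /= -mulrDl ler_pM2r ?invr_gt0//.
  have := f0 x; have := f0 y; have := f0 z; have := ler_distD (f y) (f x) (f z).
  have := ler_norm (f x - f y); have := ler_norm (f y - f z).
  have := ler_norm (f y - f x); have := ler_norm (f z - f y).
  have := ler_norm (f x - f z); have := ler_norm (f z - f x).
  rewrite (distrC (f y) (f x)) (distrC (f z) (f y)) (distrC (f z) (f x)).
  case: (asboolP (same (x, y))) => sxy; case: (asboolP (same (y, z))) => syz;
    case: (asboolP (same (x, z))) => sxz; try lra.
  + by case: sxz; exact: same_trans sxy syz.
  + by case: syz; exact: same_trans (same_sym sxy) sxz.
  + by case: sxy; exact: same_trans sxz (same_sym syz).
  + by have := ler_normB (f x) (f z); rewrite !(ger0_norm (f0 _)); lra.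
Qed.

Lemma hedgehog_eq0 y z : hedgehog (y, z) = 0 -> f y != 0 ->
  exists i, [/\ D i, O i y & O i z].
Proof.
rewrite /hedgehog /=; case: asboolP => [//|_ H fy0].
by have := f0 y; have := f0 z; move=> *; case/eqP: fy0; lra.
Qed.

(** A point of small height is almost at the centre.  This bound holds whether or not
    the spines agree, hence controls the places where they vary wildly. *)
Let hedgehog_squeeze y z : `|hedgehog (y, z) - f z / 2| <= f y / 2.
Proof.
rewrite /hedgehog /= -mulrBl normrM (ger0_norm (_ : 0 <= 2^-1)) ?invr_ge0//.
rewrite ler_pM2r ?invr_gt0//; case: ifP => _; last by rewrite addrK ger0_norm.
rewrite ler_norml; have := ler_normB (f y) (f z); have := ler_norm (f z - f y).
by rewrite (distrC (f z)) !(ger0_norm (f0 _)); lra.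
Qed.

Lemma hedgehog_continuous : continuous hedgehog.
Proof.
have c1 : continuous (f \o fst : Y * Y -> R).
  by move=> p; apply: continuous_comp; [exact: cvg_fst|exact: cf].
have c2 : continuous (f \o snd : Y * Y -> R).
  by move=> p; apply: continuous_comp; [exact: cvg_snd|exact: cf].
have cD : continuous (fun p : Y * Y => (f p.1 + f p.2) / 2).
  by move=> p; apply: cvgM; [apply: cvgD; [exact: c1|exact: c2]|exact: cvg_cst].
have cB : continuous (fun p : Y * Y => `|f p.1 - f p.2| / 2).
  move=> p; apply: cvgM; last exact: cvg_cst.
  by apply: cvg_norm; apply: cvgB; [exact: c1|exact: c2].
have h0 y z : f y = 0 -> hedgehog @ (y, z) --> f z / 2.
  move=> fy0; apply/cvgrPdist_le => e e0.
  have n1 : \forall p \near (y, z), f p.1 < e.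
    by apply: (cvgr_lt _ (c1 (y, z))); rewrite /= fy0.
  have n2 : \forall p \near (y, z), `|f z - f p.2| < e.
    by have /cvgrPdist_lt := c2 (y, z); apply.
  near=> p; rewrite (surjective_pairing p) distrC.
  apply: (le_trans (ler_distD (f p.2 / 2) _ _)).
  apply: (le_trans (lerD (hedgehog_squeeze _ _) (lexx _))).
  rewrite -mulrBl normrM (ger0_norm (_ : 0 <= 2^-1)) ?invr_ge0// distrC.
  have : f p.1 < e by near: p.
  have : `|f z - f p.2| < e by near: p.
  by lra.
have hsym y z : hedgehog (y, z) = hedgehog (z, y) by case: hedgehog_pseudometric.
have hx0 y z : f y = 0 -> hedgehog (y, z) = f z / 2.
  move=> fy0; apply/eqP; rewrite -subr_eq0 -normr_le0.
  by apply: (le_trans (hedgehog_squeeze _ _)); rewrite fy0 mul0r.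
move=> [y z]; rewrite /continuous_at.
have [fy0|/[dup] fyn0 /fO [i Di Oi]] := eqVneq (f y) 0.
  by rewrite hx0//; exact: h0.
have [fz0|/[dup] fzn0 /fO [j Dj Oj]] := eqVneq (f z) 0.
  rewrite hsym hx0 //; have -> : hedgehog = hedgehog \o (fun p => (p.2, p.1)).
    by apply/funext => -[u v] /=.
  apply: (cvg_comp (fun p : Y * Y => (p.2, p.1)) hedgehog _ (h0 _ y fz0)).
  by apply: cvg_pair; [exact: cvg_snd|exact: cvg_fst].
have nij : \forall p \near (y, z), O i p.1 /\ O j p.2.
  exists (O i, O j) => //=; split; apply: open_nbhs_nbhs; split => //; exact: oO.
have [ij|ij] := pselect (i = j).
  have hE : {near (y, z), hedgehog =1 (fun p => `|f p.1 - f p.2| / 2)}.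
    near=> p; have [Op1 Op2] : O i p.1 /\ O j p.2 by near: p.
    rewrite /hedgehog; case: asboolP => // -[]; exists i; split => //.
    by rewrite ij.
  rewrite (nbhs_singleton hE).
  by apply: cvg_trans (cB (y, z)); apply: near_eq_cvg; near do apply/esym.
have hE : {near (y, z), hedgehog =1 (fun p => (f p.1 + f p.2) / 2)}.
  near=> p; have [Op1 Op2] : O i p.1 /\ O j p.2 by near: p.
  rewrite /hedgehog; case: asboolP => // -[k [Dk Ok1 Ok2]]; case: ij.
  by rewrite (disjO Di Dk Op1 Ok1) (disjO Dj Dk Op2 Ok2).
rewrite (nbhs_singleton hE).
by apply: cvg_trans (cD (y, z)); apply: near_eq_cvg; near do apply/esym.
Unshelve. all: by end_near. Qed.

End hedgehog.

(** * Continuous metrics and controlled retractions *)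

Section stratified_constructions.
Context (R : realType) (Y : topologicalType) (T1Y : accessible_space Y).
Context (S : set Y -> nat -> set Y) (stratS : stratification S).

(** If the pseudometrics built on refinements of the covers [gnbhs k x] all vanish at
    [(y, z)], then for each [k] both points lie in a common [gnbhs k x], and such
    [x] would have to be close to [y] and to [z] at once. *)
Lemma stratified_continuous_metric : exists m : Y * Y -> R,
  [/\ unit_valued m, continuous m & is_metric m].
Proof.
have H k : exists d : nat -> Y * Y -> R,
    [/\ forall n, unit_valued (d n), forall n, continuous (d n),
        forall n, is_pseudometric (d n)
      & forall y z, (forall n, d n (y, z) = 0) ->
          exists x, gnbhs S k x y /\ gnbhs S k x z].
  have [V [oV Vgn disjV covV]] := sigma_disjoint_refinement T1Y stratS
    (fun x (_ : [set: Y] x) => @open_gnbhs Y S k x).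
  have oVn n : open (\bigcup_(x in [set: Y]) V n x) by apply: bigcup_open => x _; exact: oV.
  have [f fP] := choice (fun n => stratified_cozero R T1Y stratS (oVn n)).
  have f01 n : unit_valued (f n) by case: (fP n).
  have cf n : continuous (f n) by case: (fP n).
  have fO n y : f n y != 0 -> exists2 i, setT i & V n i y.
    by have [_ _ /(_ y)[_ /[apply]]] := fP n.
  exists (fun n => hedgehog setT (V n) (f n)); split.
  - by move=> n; apply: hedgehog_unit_valued.
  - move=> n; apply: hedgehog_continuous.
    + exact: oV.
    + exact: disjV.
    + exact: f01.
    + exact: cf.
    + exact: fO.
  - by move=> n; apply: hedgehog_pseudometric; [exact: disjV|exact: f01|exact: fO].
  move=> y z d0.
  have [n [x _ Vxy]] := covV y y I (@gnbhs_self _ T1Y _ stratS k y).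
  have fy : f n y != 0 by have [_ _ /(_ y)[+ _]] := fP n; apply; exists x.
  have [i [_ Viy Viz]] := hedgehog_eq0 (f01 n) (d0 n) fy.
  by exists i; split; exact: (Vgn n i).
have [d dP] := choice H.
have d01 k n : unit_valued (d k n) by case: (dP k).
have d01' k : unit_valued (wsup (d k)) by exact: wsup_unit_valued.
exists (wsup (fun k => wsup (d k))); split.
- exact: wsup_unit_valued.
- by apply: wsup_continuous => // k; apply: wsup_continuous => //; case: (dP k).
split.
  by apply: wsup_pseudometric => // k; apply: wsup_pseudometric => //; case: (dP k).
move=> y z /(wsup_eq0 d01') d0.
have {d0} yz k : exists x, gnbhs S k x y /\ gnbhs S k x z.
  by have [_ _ _] := dP k; apply; apply/(wsup_eq0 (d01 k)).
apply: contrapT => yNz; have [oS cS exS _ nS] := stratS.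
(* [O] and [P] are disjoint open neighbourhoods of [y] and [z]. *)
have oz := open_setC1 T1Y z.
have [m SOm] := exS _ _ oz yNz.
pose O := S (~` [set z]) m; pose P := ~` closure O.
have oO : open O by exact: oS.
have oP : open P by apply: closed_openC; exact: closed_closure.
have Pz : P z by move=> /(cS _ _ oz); apply.
have [i SOi] := exS _ _ oO SOm; have [j SPj] := exS _ _ oP Pz.
have [x [gy gz]] := yz (maxn i j).
have Ox : O x.
  apply: contrapT => nOx; apply: (gnbhs_disjoint T1Y stratS oO nOx SOi).
  by apply: gnbhs_anti gy; rewrite ?leq_maxl.
have Px : P x.
  apply: contrapT => nPx; apply: (gnbhs_disjoint T1Y stratS oP nPx SPj).
  by apply: gnbhs_anti gz; rewrite ?leq_maxr.
by apply: Px; exact: subset_closure.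
Qed.

Context (X : set Y) (closedX : closed X) (x0 : X).

Lemma nbhs_set_type (x : X) (O : set X) : nbhs x O ->
  exists2 W : set Y, open W /\ W (set_val x) & forall z : X, W (set_val z) -> O z.
Proof.
move=> [_ [[/= W oW <-]] /= Wx sub]; exists W => // z Wz; exact: sub.
Qed.

(** The centre [a w] is a point [x] of [X] whose neighbourhood [gnbhs j x] contains [w]
    for the largest possible [j].  If [w] is close to some point of [X], at depth [k],
    then [w] is in [gnbhs k (a w)], which forces [a w] to be close as well. *)
Lemma controlled_cover : exists (U : Y -> set Y) (a : Y -> X),
  [/\ forall w, ~ X w -> [/\ open (U w), U w w & U w `<=` ~` X]
    & forall (x : X) O, nbhs x O ->
        \forall z \near set_val x, forall w, ~ X w -> U w z -> O (a w)].
Proof.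
have oX : open (~` X) by exact: closed_openC.
have [oS cS exS mS nS] := stratS.
have oG k x := @open_gnbhs Y S k x.
have H w : exists na : nat * X, ~ X w ->
    S (~` X) na.1 w /\ forall j (x : X), gnbhs S j (set_val x) w ->
       gnbhs S j (set_val na.2) w.
  have [Xw|Xw] := pselect (X w); first by exists (0, x0).
  have [n Sn] := exS _ _ oX Xw.
  have disj j (x : X) : gnbhs S j (set_val x) w -> (j < n)%N.
    move=> gj; rewrite ltnNge; apply/negP => nj.
    apply: (gnbhs_disjoint T1Y stratS oX _ (nS _ _ _ nj _ Sn) gj).
    by apply; exact: set_valP.
  pose p j := `[< exists x : X, gnbhs S j (set_val x) w >].
  have [exp|Np] := pselect (exists j, p j); last first.
    exists (n, x0) => _; split => // j x gj; case: Np; exists j.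
    by apply/asboolP; exists x.
  have ubp j : p j -> (j <= n)%N by move=> /asboolP[x /disj/ltnW].
  have [i /asboolP[x gi] maxi] := ex_maxnP exp ubp.
  exists (n, x) => _; split => //= k z gk; apply: gnbhs_anti gi => //.
  by apply: maxi; apply/asboolP; exists z.
have [na naP] := choice H.
pose U w := S (~` X) (na w).1 `&` gnbhs S (na w).1 w.
exists U, (fun w => (na w).2); split.
  move=> w Xw; have [Sw _] := naP w Xw; split.
  - by apply: openI; [exact: oS|exact: oG].
  - by split => //; exact: gnbhs_self.
  - by move=> z [Sz _]; apply: (cS _ (na w).1 oX); exact: subset_closure.
(* This is [stratified_sep] for the open sets [~` X] and [W], the first of which does
   not contain [x]. *)
have centre (x : X) W : open W -> W (set_val x) -> exists2 V : set Y,
    open V /\ V (set_val x) & forall w z, ~ X w -> U w z -> V z -> W w.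
  move=> oW Wx; have [k Sk] := exS _ _ oW Wx.
  exists (S W k `&` gnbhs S k (set_val x)).
    by split; [apply: openI; [exact: oS|exact: oG]|split => //; exact: gnbhs_self].
  move=> w z Xw [SXz gwz] [SWz gxz]; apply: contrapT => nWw.
  apply: (stratified_sep T1Y stratS oX oW _ nWw SXz gwz SWz gxz).
  by apply; exact: set_valP.
move=> x O /nbhs_set_type[W [oW Wx] WO].
have [k Sk] := exS _ _ oW Wx.
have [||V [oV Vx] Vc] := centre x (S W k `&` gnbhs S k (set_val x)).
- by apply: openI; [exact: oS|exact: oG].
- by split => //; exact: gnbhs_self.
apply: filterS (open_nbhs_nbhs (conj oV Vx)) => z Vz w Xw Uwz.
have [Sw gw] := Vc w z Xw Uwz Vz.
apply: WO; apply: contrapT => nW.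
apply: (gnbhs_disjoint T1Y stratS oW nW Sw).
by have [_] := naP w Xw; apply; exact: gw.
Qed.

(** Functions [f n] covering the complement of [X], each with a locally constant map
    into [X] where it does not vanish.  Only the last clause ties the maps to the
    inclusion of [X]: near [X] they move points little. *)
Definition retraction_system (f : nat -> Y -> R) (c : nat -> Y -> X) :=
  [/\ forall n, unit_valued (f n), forall n, continuous (f n),
      forall y, X y <-> forall n, f n y = 0,
      forall n y, f n y != 0 -> \forall z \near y, c n z = c n y
    & forall (x : X) O, nbhs x O ->
        \forall z \near set_val x, forall n, f n z != 0 -> O (c n z)].

Lemma stratified_retraction_system : exists f c, retraction_system f c.
Proof.
have [U [a [UP Ua]]] := controlled_cover.
have [V [oV VU disjV covV]] := sigma_disjoint_refinement T1Y stratS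
  (fun w Xw => let: And3 oU _ _ := UP w Xw in oU).
have oVn n : open (\bigcup_(w in ~` X) V n w).
  by apply: bigcup_open => x; exact: oV.
have [f fP] := choice (fun n => stratified_cozero R T1Y stratS (oVn n)).
pose c n y := a (xget (set_val x0) [set w | ~ X w /\ V n w y]).
have cE n w y : ~ X w -> V n w y -> c n y = a w.
  move=> Xw Vw; rewrite /c; case: xgetP => [w' _ [Xw' Vw']|/(_ w)]; last by case.
  by rewrite (disjV n w w' y).
have fO n y : f n y != 0 <-> exists2 w, ~ X w & V n w y.
  by have [_ _ /(_ y)[H1 H2]] := fP n; split=> [/H2|/H1].
exists f, c; split.
- by move=> n; case: (fP n).
- by move=> n; case: (fP n).
- move=> y; split=> [Xy n|f0].
    apply/eqP; apply: contrapT => /negP /fO[w Xw Vw].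
    by have [_ _ /(_ y)] := UP w Xw; apply => //; exact: VU Vw.
  apply: contrapT => Xy; have [_ Uy _] := UP y Xy.
  have [n [w Xw Vw]] := covV y y Xy Uy.
  have : f n y != 0 by apply/fO; exists w.
  by rewrite f0 eqxx.
- move=> n y /fO[w Xw Vw]; rewrite (cE n w y)//.
  by apply: filterS (open_nbhs_nbhs (conj (oV n w Xw) Vw)) => z; exact: cE.
- move=> x N /Ua; apply: filterS => z H n /fO[w Xw Vw].
  by rewrite (cE n w z)//; apply: H => //; exact: VU Vw.
Qed.

End stratified_constructions.

(** * Finitely valued measurable maps on the unit interval *)

Lemma finite_bounded (R : realType) (I : choiceType) (D : set I) (f : I -> R) :
  finite_set D -> exists2 M, 0 <= M & forall i, D i -> `|f i| <= M.
Proof.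
move=> /finite_seqP[s ->]; exists (\sum_(i <- s) `|f i|).
  by apply: sumr_ge0 => *; exact: normr_ge0.
move=> i /= si; rewrite (big_rem _ si)/= lerDl.
by apply: sumr_ge0 => *; exact: normr_ge0.
Qed.

Section simple_maps.
Context (R : realType).
Implicit Types (Z : Type).
Local Notation mu := (@lebesgue_measure R).

Definition unit_itv : set R := `[0, 1]%classic.

(** [Z] is treated as a discrete measurable space, so that [g \o E] can be integrated
    for every function [g], however irregular. *)
Definition simple_map Z (E : R -> Z) :=
  finite_set (E @` unit_itv) /\
  forall B : set Z, measurable (unit_itv `&` E @^-1` B).

Lemma measurable_unit_itv : measurable unit_itv.
Proof. exact: measurable_itv. Qed.

Lemma mu_unit_itv : mu unit_itv = 1%:E.
Proof. by rewrite /unit_itv lebesgue_measure_itv /= lte_fin ltr01 oppr0 adde0. Qed.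

Lemma simple_map_cst Z (z : Z) : simple_map (fun=> z).
Proof.
split; first by apply: sub_finite_set (finite_set1 z) => _ [? _ <-].
move=> B; have [Bz|Bz] := pselect (B z).
  rewrite (_ : _ @^-1` B = setT); last by apply/seteqP; split.
  by rewrite setIT; exact: measurable_unit_itv.
by rewrite (_ : _ @^-1` B = set0) ?setI0//; apply/seteqP; split.
Qed.

Lemma simple_map_comp Z Z' (E : R -> Z) (g : Z -> Z') :
  simple_map E -> simple_map (g \o E).
Proof.
move=> [fE mE]; split; first by rewrite -image_comp; exact: finite_image.
by move=> B; rewrite comp_preimage; exact: mE.
Qed.

Lemma simple_map_pair Z Z' (E : R -> Z) (E' : R -> Z') :
  simple_map E -> simple_map E' -> simple_map (fun t => (E t, E' t)).
Proof.
move=> [fE mE] [fE' mE']; split.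
  apply: sub_finite_set (finite_setX fE fE') => _ [t It <-].
  by split; exists t.
move=> B; rewrite (_ : _ `&` _ = \bigcup_(z in E @` unit_itv)
    ((unit_itv `&` E @^-1` [set z]) `&`
     (unit_itv `&` E' @^-1` [set z' | B (z, z')]))).
  by apply: fin_bigcup_measurable => // z _; exact: measurableI.
apply/seteqP; split=> [t [It Bt]|t [_ [s Is <-]] [[It /= ->] [_ Bt]]] //.
by exists (E t) => //; exists t.
Qed.

Lemma simple_map_bounded (f : R -> R) : simple_map f ->
  exists M, forall t, unit_itv t -> `|f t| <= M.
Proof.
move=> [/(finite_bounded id)[M _ fM] _]; exists M => t It.
by apply: fM; exists t.
Qed.

Lemma simple_map_integrable (f : R -> R) : simple_map f ->
  mu.-integrable unit_itv (EFin \o f).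
Proof.
move=> sf; apply: measurable_bounded_integrable.
- exact: measurable_unit_itv.
- by rewrite [ltLHS]mu_unit_itv ltry.
- by move=> _ B _; exact: sf.2.
- have [M fM] := simple_map_bounded sf; exists M; split; first exact: num_real.
  by move=> N /ltW MN t It /=; exact: le_trans (fM _ It) MN.
Qed.

Definition mean (f : R -> R) : R := \int[mu]_(t in unit_itv) f t.

Lemma mean_cst c : mean (fun=> c) = c.
Proof.
rewrite /mean Rintegral_cst; last exact: measurable_unit_itv.
by rewrite [X in fine X]mu_unit_itv mulr1.
Qed.

Lemma eq_mean (f g : R -> R) : (forall t, unit_itv t -> f t = g t) ->
  mean f = mean g.
Proof. by move=> fg; apply: eq_Rintegral => t /set_mem; exact: fg. Qed.

Lemma meanD (f g : R -> R) : simple_map f -> simple_map g ->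
  mean (fun t => f t + g t) = mean f + mean g.
Proof.
move=> sf sg; apply: RintegralD.
- exact: measurable_unit_itv.
- exact: simple_map_integrable.
- exact: simple_map_integrable.
Qed.

Lemma meanZ k (f : R -> R) : simple_map f -> mean (fun t => k * f t) = k * mean f.
Proof.
move=> sf; apply: RintegralZl; first exact: measurable_unit_itv.
exact: simple_map_integrable.
Qed.

Lemma meanB (f g : R -> R) : simple_map f -> simple_map g ->
  mean (fun t => f t - g t) = mean f - mean g.
Proof.
move=> sf sg; apply: RintegralB.
- exact: measurable_unit_itv.
- exact: simple_map_integrable.
- exact: simple_map_integrable.
Qed.

Lemma le_mean (f g : R -> R) : simple_map f -> simple_map g ->
  (forall t, unit_itv t -> f t <= g t) -> mean f <= mean g.
Proof.
move=> sf sg fg; apply: le_Rintegral => //.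
- exact: measurable_unit_itv.
- exact: simple_map_integrable.
- exact: simple_map_integrable.
Qed.

Lemma simple_map_indic (B : set R) : measurable B -> simple_map (\1_B : R -> R).
Proof.
move=> mB; split.
  apply: sub_finite_set (finite_set2 0 1) => _ [t _ <-].
  by rewrite indicE; case: (_ \in _); [right|left].
move=> C; apply: measurableI; first exact: measurable_unit_itv.
by rewrite preimage_indic; do 2 case: ifP => _ //; exact: measurableC.
Qed.

Lemma mean_indic (B : set R) : measurable B ->
  mean \1_B = fine (mu (B `&` unit_itv)).
Proof.
by move=> mB; rewrite /mean /Rintegral integral_indic//; exact: measurable_unit_itv.
Qed.

Lemma mean_indic_le (B : set R) e : measurable B -> (mu B <= e%:E)%E ->
  mean \1_B <= e.
Proof.
move=> mB Be; rewrite mean_indic//.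
have Be' : (mu (B `&` unit_itv) <= e%:E)%E.
  apply: le_trans Be; apply: le_measure => //; rewrite inE//.
  by apply: measurableI => //; exact: measurable_unit_itv.
by rewrite -lee_fin fineK// ge0_fin_numE// (le_lt_trans Be')// ltry.
Qed.

Lemma norm_mean_le (f : R -> R) M : simple_map f ->
  (forall t, unit_itv t -> `|f t| <= M) -> `|mean f| <= M.
Proof.
move=> sf fM; rewrite ler_norml -{1}(mean_cst (- M)) -{2}(mean_cst M).
apply/andP; split; apply: le_mean => //; try exact: simple_map_cst.
- by move=> t /fM; rewrite ler_norml => /andP[].
- by move=> t /fM; rewrite ler_norml => /andP[].
Qed.

(** The estimate behind convergence in measure: small off [B], bounded on [B]. *)
Lemma norm_mean_near_le (f : R -> R) (B : set R) M e e' : simple_map f ->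
  measurable B -> (mu B <= e'%:E)%E -> 0 <= M -> 0 <= e ->
  (forall t, unit_itv t -> `|f t| <= M) ->
  (forall t, unit_itv t -> ~ B t -> `|f t| <= e) ->
  `|mean f| <= e + M * e'.
Proof.
move=> sf mB Be M0 e0 fM fe; pose g t : R := e + M * \1_B t.
have sB := simple_map_indic mB.
have sg : simple_map g by exact: (simple_map_comp (fun r => e + M * r) sB).
have sNg : simple_map (fun t => - 1 * g t) by exact: (simple_map_comp (fun r => - 1 * r) sg).
have fg t : unit_itv t -> `|f t| <= g t.
  move=> It; rewrite /g indicE; have [Bt|/negP Bt] := boolP (t \in B).
    by rewrite mulr1 (le_trans (fM _ It))// lerDr.
  by rewrite mulr0 addr0 fe// => /mem_set.
have mg : mean g <= e + M * e'.
  rewrite /g meanD ?mean_cst ?meanZ//; [|exact: simple_map_cst|].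
    by rewrite lerD2l ler_wpM2l// mean_indic_le.
  exact: (simple_map_comp (fun r => M * r) sB).
apply: le_trans mg; rewrite ler_norml -mulN1r -meanZ//.
apply/andP; split; apply: le_mean => // t /fg; rewrite ler_norml => /andP[] //.
by rewrite mulN1r.
Qed.

Lemma mean_gt0 (f : R -> R) (c d : R) : simple_map f -> 0 < c -> 0 < d <= 1 ->
  (forall t, unit_itv t -> 0 <= f t) ->
  (forall t, 1 - d <= t <= 1 -> c <= f t) -> 0 < mean f.
Proof.
move=> sf c0 /andP[d0 d1] f0 fc; pose B : set R := `[1 - d, 1]%classic.
have mB : measurable B by exact: measurable_itv.
have sB := simple_map_indic mB.
apply: (@lt_le_trans _ _ (mean (fun t => c * \1_B t))).
  rewrite meanZ// mean_indic// pmulr_rgt0// (_ : _ `&` _ = B).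
    rewrite /B lebesgue_measure_itv/= lte_fin ltrBlDr ltrDl d0.
    by rewrite -EFinB /= opprB addrC subrK.
  apply: setIidl => t; rewrite /B /unit_itv /= !in_itv /= => /andP[dt ->].
  by rewrite andbT (le_trans _ dt)// subr_ge0.
apply: le_mean => //; first exact: (simple_map_comp (fun r => c * r) sB).
move=> t It; rewrite indicE; have [|_] := boolP (t \in B); last by rewrite mulr0 f0.
by rewrite inE mulr1 /B /= in_itv; exact: fc.
Qed.

End simple_maps.
Arguments unit_itv {R}.

(** * The averaging operator of a random retraction *)

Lemma finite_near (T : Type) (I : choiceType) (F : set_system T) (D : set I)
    (P : I -> T -> Prop) : Filter F -> finite_set D ->
  (forall i, D i -> \forall t \near F, P i t) ->
  \forall t \near F, forall i, D i -> P i t.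
Proof.
move=> FF /finite_fsetP[s ->] PF.
exact: (@filter_bigI _ _ s P F FF PF).
Qed.

(** Neighbourhoods in the disjoint union of [X] and an isolated point. *)
Definition near_option (X : topologicalType) (e : option X) : set_system (option X) :=
  if e is Some x then [set A | nbhs x (Some @^-1` A)] else [set A | A None].

Instance near_option_filter (X : topologicalType) (e : option X) :
  Filter (near_option e).
Proof.
case: e => [x|]; split => /=.
- exact: filterT.
- by move=> A B; exact: filterI.
- by move=> A B AB; apply: filterS => z; exact: AB.
- by [].
- by move=> A B.
- by move=> A B AB; exact: AB.
Qed.

Lemma near_option_self (X : topologicalType) (e : option X) A :
  near_option e A -> A e.
Proof. by case: e => [x|//]; exact: nbhs_singleton. Qed.

Section kernel.
Context (R : realType) (X : Type) (a b : X).
Implicit Types (p q : X * X -> R) (r : R) (e : option X).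

(** [p] extended to new points, represented by [None]; [r] is the distance of the two
    new points when both arguments are new.  The weights in each case are
    nonnegative and add up to [1] for [0 <= r <= 1].  A new point behaves like a fair
    mixture of [a] and [b], two new points being mixed independently for [r = 1/2]
    and identically for [r = 0]. *)
Definition kernel p r e e' : R :=
  match e, e' with
  | Some x, Some x' => p (x, x')
  | Some x, None => (p (x, a) + p (x, b)) / 2
  | None, Some x => (p (a, x) + p (b, x)) / 2
  | None, None => (1 - r) / 2 * (p (a, a) + p (b, b)) + r / 2 * (p (a, b) + p (b, a))
  end.

Lemma kernel_linear k p q r e e' :
  kernel (k *: p + q) r e e' = k * kernel p r e e' + kernel q r e e'.
Proof. by case: e => [x|]; case: e' => [x'|] //=; rewrite !fctE /GRing.scale/=; ring. Qed.

Lemma kernel_cst c r e e' : kernel (cst c) r e e' = c.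
Proof. by case: e => [x|]; case: e' => [x'|] //=; field. Qed.

Lemma kernel_ge0 p r e e' : (forall z, 0 <= p z) -> 0 <= r <= 1 ->
  0 <= kernel p r e e'.
Proof.
move=> p0 /andP[r0 r1]; case: e => [x|]; case: e' => [x'|] //=.
- by rewrite divr_ge0// addr_ge0.
- by rewrite divr_ge0// addr_ge0.
- by apply: addr_ge0; apply: mulr_ge0; rewrite ?divr_ge0 ?subr_ge0 ?addr_ge0.
Qed.

Lemma kernel_le p r e e' (L L' : set X) M : 0 <= r <= 1 ->
  (forall x, e = Some x -> L x) -> (forall x, e' = Some x -> L' x) ->
  L a -> L b -> L' a -> L' b ->
  (forall x x', L x -> L' x' -> `|p (x, x')| <= M) -> `|kernel p r e e'| <= M.
Proof.
move=> r01 Le Le' La Lb La' Lb' pM.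
have pM' x x' : L x -> L' x' -> - M <= p (x, x') <= M.
  by move=> Lx Lx'; rewrite -ler_norml; exact: pM.
rewrite ler_norml; move: Le Le'; case: e => [x|]; case: e' => [x'|] /= Le Le'.
- by apply: pM'; [exact: Le|exact: Le'].
- by have := pM' x a (Le _ erefl) La'; have := pM' x b (Le _ erefl) Lb'; lra.
- by have := pM' a x' La (Le' _ erefl); have := pM' b x' Lb (Le' _ erefl); lra.
- have := pM' a a La La'; have := pM' a b La Lb'.
  have := pM' b a Lb La'; have := pM' b b Lb Lb'.
  nra.
Qed.

Section metric.
Context p (pp : is_pseudometric p).

Let p0 x y : 0 <= p (x, y). Proof. by case: pp. Qed.
Let pxx x : p (x, x) = 0. Proof. by case: pp. Qed.
Let psym x y : p (x, y) = p (y, x). Proof. by case: pp. Qed.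
Let ptri x y z : p (x, z) <= p (x, y) + p (y, z). Proof. by case: pp. Qed.

Lemma kernel_NoneNone r : kernel p r None None = r * p (a, b).
Proof. by rewrite /= !pxx (psym b a); field. Qed.

Lemma kernel_diag e : kernel p 0 e e = 0.
Proof. by case: e => [x|]; [exact: pxx|rewrite kernel_NoneNone mul0r]. Qed.

Lemma kernel_sym r e e' : kernel p r e e' = kernel p r e' e.
Proof.
case: e => [x|]; case: e' => [x'|] //=.
- by rewrite (psym x a) (psym x b).
- by rewrite (psym x' a) (psym x' b).
Qed.

(** Going from a new point to a new point through [x] in [X] costs at least [p (a, b)]
    by the triangle inequality for [a], [x], [b]; this is where [r <= 1] is needed. *)
Lemma kernel_triangle r r12 r23 e1 e2 e3 :
  0 <= r <= 1 -> 0 <= r12 -> 0 <= r23 -> r <= r12 + r23 ->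
  kernel p r e1 e3 <= kernel p r12 e1 e2 + kernel p r23 e2 e3.
Proof.
move=> /andP[r0 r1] r120 r230 rr.
have rab : r * p (a, b) <= p (a, b) by rewrite ler_piMl.
have r12ab : 0 <= r12 * p (a, b) by rewrite mulr_ge0.
have r23ab : 0 <= r23 * p (a, b) by rewrite mulr_ge0.
have rrab : r * p (a, b) <= r12 * p (a, b) + r23 * p (a, b).
  by rewrite -mulrDl ler_wpM2r.
case: e1 => [x|]; case: e2 => [y|]; case: e3 => [z|]; rewrite ?kernel_NoneNone//=.
- by have := ptri x y a; have := ptri x y b; lra.
- by have := ptri x a z; have := ptri x b z; lra.
- by lra.
- by have := ptri a y z; have := ptri b y z; lra.
- by have := ptri a y b; rewrite (psym b y) (psym a y); lra.
- by lra.
Qed.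

End metric.

End kernel.

Lemma kernel_near (R : realType) (X : topologicalType) (a b : X) (p : X * X -> R)
    (r0 : R) (e0 e0' : option X) (e : R) : continuous p -> 0 < e ->
  exists A A', [/\ near_option e0 A, near_option e0' A' &
    \forall r \near r0, forall z z', A z -> A' z' ->
      `|kernel a b p r z z' - kernel a b p r0 e0 e0'| <= e].
Proof.
move=> cp e_gt0.
have cp1 x c : p (z, c) @[z --> x] --> p (x, c).
  apply: (@continuous_comp _ _ _ (fun z => (z, c)) p x _ (cp _)).
  by apply: cvg_pair; [exact: cvg_id|exact: cvg_cst].
have cp2 c x : p (c, z) @[z --> x] --> p (c, x).
  apply: (@continuous_comp _ _ _ (fun z => (c, z)) p x _ (cp _)).
  by apply: cvg_pair; [exact: cvg_cst|exact: cvg_id].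
have near_le (T : Type) (F : set_system T) (f : T -> R) l : Filter F -> f @ F --> l ->
    \forall t \near F, `|f t - l| <= e.
  move=> FF /cvgrPdist_le/(_ _ e_gt0); apply: filterS => t.
  by rewrite distrC.
case: e0 => [x|]; case: e0' => [x'|].
- have /near_le[[N N'] [Nx Nx'] NN] := cp (x, x').
  exists (Some @` N), (Some @` N'); split.
  + by apply: filterS Nx => z Nz; exists z.
  + by apply: filterS Nx' => z Nz; exists z.
  + apply: (@filterE _ (nbhs r0)) => r _ _ [z Nz <-] [z' Nz' <-] /=.
    by apply: (NN (z, z')).
- have /near_le H : (p (z, a) + p (z, b)) / 2 @[z --> x] --> (p (x, a) + p (x, b)) / 2.
    by apply: cvgM; [apply: cvgD; exact: cp1|exact: cvg_cst].
  exists (Some @` [set z |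
    `|(p (z, a) + p (z, b)) / 2 - (p (x, a) + p (x, b)) / 2| <= e]), [set None].
  split => //.
  + by apply: filterS H => z Oz; exists z.
  + by apply: (@filterE _ (nbhs r0)) => r _ _ [z Oz <-] ->.
- have /near_le H : (p (a, z) + p (b, z)) / 2 @[z --> x'] --> (p (a, x') + p (b, x')) / 2.
    by apply: cvgM; [apply: cvgD; exact: cp2|exact: cvg_cst].
  exists [set None], (Some @` [set z |
    `|(p (a, z) + p (b, z)) / 2 - (p (a, x') + p (b, x')) / 2| <= e]).
  split => //.
  + by apply: filterS H => z Oz; exists z.
  + by apply: (@filterE _ (nbhs r0)) => r _ _ -> [z Oz <-].
- exists [set None], [set None]; split => //.
  have /near_le : kernel a b p r None None @[r --> r0] --> kernel a b p r0 None None.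
    apply: cvgD; apply: cvgM; try exact: cvg_cst; apply: cvgM; try exact: cvg_cst.
      by apply: cvgB; [exact: cvg_cst|exact: cvg_id].
    exact: cvg_id.
  by apply: filterS => r H _ _ -> ->.
Qed.

(** The third and fourth clauses say that the value is new on a final interval of times
    outside [X].  In the last clause, [K] is finite and depends on [y0] alone, whereas
    the displacement [A] and the measure [e] of exceptional times are arbitrary: near
    [y0] every value is in [K] or close to a value at [y0], and for most times it is
    close to the value at [y0] at the same time. *)
Definition random_retraction (R : realType) (Y : topologicalType) (X : set Y)
    (E : Y -> R -> option X) :=
  [/\ forall y, simple_map (E y),
      forall (x : X) t, E (set_val x) t = Some x,
      forall y, exists2 d, 0 < d <= 1 & forall t, 1 - d <= t <= 1 -> E y t = E y 1,
      forall y, ~ X y -> E y 1 = None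
    & forall y0, exists2 K : set (option X), finite_set K &
        forall A (e : R), (forall z, near_option z (A z)) -> 0 < e ->
        exists2 B, measurable B /\ (lebesgue_measure B <= e%:E)%E &
        \forall y \near y0, forall t, unit_itv t ->
          (K (E y t) \/ exists2 s, unit_itv s & A (E y0 s) (E y t)) /\
          (~ B t -> A (E y0 t) (E y t))].

Section operator.
Context (R : realType) (Y : topologicalType) (X : set Y) (a b : X).
Context (m : Y * Y -> R) (E : Y -> R -> option X).
Hypotheses (m01 : unit_valued m) (cm : continuous m) (mm : is_metric m).
Hypothesis rE : random_retraction E.

Let sE y : simple_map (E y). Proof. by case: rE. Qed.
Let EX (x : X) t : E (set_val x) t = Some x. Proof. by case: rE. Qed.

Let integrand (p : X * X -> R) y y' t := kernel a b p (m (y, y')) (E y t) (E y' t).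

Let simple_integrand p y y' : simple_map (integrand p y y').
Proof.
exact: (simple_map_comp (fun z => kernel a b p (m (y, y')) z.1 z.2)
  (simple_map_pair (sE y) (sE y'))).
Qed.

Definition average (p : X * X -> R) (w : Y * Y) : R :=
  mean (fun t => kernel a b p (m w) (E w.1 t) (E w.2 t)).

Let averageE p y y' : average p (y, y') = mean (integrand p y y'). Proof. by []. Qed.

Lemma average_linear : linear average.
Proof.
move=> k p q; apply/funext => -[y y'].
rewrite [RHS](_ : _ = k * average p (y, y') + average q (y, y')) //.
rewrite !averageE -meanZ// -meanD//.
  by apply: eq_mean => t _; exact: kernel_linear.
exact: (simple_map_comp (fun z => k * z) (simple_integrand p y y')).
Qed.

Lemma average_extension : extension_operator average.
Proof.
move=> p x x'; rewrite averageE -[RHS]mean_cst.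
by apply: eq_mean => t _; rewrite /integrand !EX.
Qed.

Lemma average_positive : positive_operator average.
Proof. by move=> p p0 w; apply: Rintegral_ge0 => t _; exact: kernel_ge0. Qed.

Lemma average_cst : preserves_constants average.
Proof.
move=> c; apply/funext => w; rewrite /= -[RHS]mean_cst.
by apply: eq_mean => t _; exact: kernel_cst.
Qed.

(** The values of [average p] at pairs of points of [C] depend only on the restriction
    of [p] to pairs from this set ([average_le]). *)
Definition carrier (C : set Y) : set X :=
  [set a; b] `|` [set x | exists y t, [/\ C y, unit_itv t & E y t = Some x]].

Lemma average_le p (C C' : set Y) M y y' : C y -> C' y' ->
  (forall x x', carrier C x -> carrier C' x' -> `|p (x, x')| <= M) ->
  `|average p (y, y')| <= M.
Proof.
move=> Cy Cy' pM; apply: norm_mean_le; first exact: simple_integrand.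
move=> t It.
apply: (kernel_le (m01 _) _ _ _ _ _ _ pM); do ?[by left; left|by left; right].
- by move=> x Ex; right; exists y, t.
- by move=> x Ex; right; exists y', t.
Qed.

Lemma average_bounded : preserves bounded_fun bounded_fun average.
Proof.
move=> p [M [Mr Mp]]; exists M; split => // N MN [y y'] _ /=.
by apply: (@average_le p setT setT) => // x x' _ _; exact: Mp.
Qed.

Lemma average_pseudometric :
  preserves (@is_pseudometric R X) (@is_pseudometric R Y) average.
Proof.
move=> p pp; have [mp _] := mm; have [m0 mxx msym mtri] := mp.
split.
- by move=> x y; apply: average_positive => -[]; case: pp.
- move=> y; rewrite averageE -[RHS]mean_cst; apply: eq_mean => t _.
  by rewrite /integrand mxx kernel_diag.
- move=> x y; apply: eq_mean => t _ /=; rewrite msym; exact: kernel_sym.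
- move=> x y z; rewrite !averageE -meanD//; apply: le_mean => //.
    exact: (simple_map_comp (fun z => z.1 + z.2)
      (simple_map_pair (simple_integrand p x y) (simple_integrand p y z))).
  by move=> t _; apply: kernel_triangle.
Qed.

(** Near the end of the time interval both values are constant, and the kernel is
    positive at the final values of distinct points. *)
Lemma average_metric : a <> b -> preserves (@is_metric R X) (@is_metric R Y) average.
Proof.
move=> ab p [pp pi]; split; first exact: average_pseudometric.
have [p0 _ psym _] := pp; have [[m0 _ _ _] mi] := mm.
have p_gt0 x x' : x <> x' -> 0 < p (x, x').
  by move=> xx'; rewrite lt_neqAle p0 andbT eq_sym; apply/eqP => /pi.
have pab x : 0 < p (x, a) + p (x, b).
  have [<-|xa] := pselect (a = x).
    by rewrite ltr_wpDl// p_gt0.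
  by rewrite ltr_wpDr// p_gt0// => /esym.
move=> y y' avg0; apply: contrapT => yy'.
have [_ _ Eend EN _] := rE.
suff : 0 < average p (y, y') by rewrite avg0 ltxx.
have [d /andP[d0 d1] Ed] := Eend y; have [d' /andP[d0' d1'] Ed'] := Eend y'.
have k_gt0 : 0 < integrand p y y' 1.
  have Ey z : E z 1 = if pselect (X z) is left Xz then Some (SigSub (mem_set Xz)) else None.
    case: pselect => [Xz|Xz]; last exact: EN.
    exact: (EX (SigSub (mem_set Xz)) 1).
  rewrite /integrand !Ey; case: pselect => Xy; case: pselect => Xy'.
  - by apply: p_gt0 => -[].
  - by rewrite /= divr_gt0.
  - by rewrite /= (psym a) (psym b) divr_gt0.
  - rewrite kernel_NoneNone// mulr_gt0 ?p_gt0//.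
    by rewrite lt_neqAle m0 andbT eq_sym; apply/eqP => /mi.
apply: (@mean_gt0 _ _ (integrand p y y' 1) (Num.min d d')) => //.
- exact: simple_integrand.
- by rewrite lt_min d0 d0' ge_min d1.
- by move=> t _; apply: kernel_ge0 => // -[].
move=> t /andP[dt t1]; rewrite /integrand Ed ?Ed' ?t1 ?andbT ?(le_trans _ dt)//.
  by rewrite lerD2l lerN2 ge_min lexx orbT.
by rewrite lerD2l lerN2 ge_min lexx.
Qed.

(** [p] need not be bounded, so convergence in measure of the values has to be combined
    with a local bound of the integrand: near [(y0, y0')] all values are close to
    those in the finite sets [F] and [F']. *)
Lemma average_continuous :
  preserves (fun p : X * X -> R => continuous p)
            (fun q : Y * Y -> R => continuous q) average.
Proof.
move=> p cp [y0 y0']; rewrite /continuous_at; apply/cvgrPdist_le => e e_gt0.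
have [_ _ _ _ locE] := rE.
have [K finK KP] := locE y0; have [K' finK' KP'] := locE y0'.
pose r0 := m (y0, y0').
pose F := K `|` E y0 @` unit_itv; pose F' := K' `|` E y0' @` unit_itv.
have finF : finite_set F by rewrite finite_setU; split => //; case: (sE y0).
have finF' : finite_set F' by rewrite finite_setU; split => //; case: (sE y0').
have finFF := finite_setX finF finF'.
have [M M0 MP] := finite_bounded (fun z => kernel a b p r0 z.1 z.2) finFF.
pose e1 := Num.min 1 (e / 2); have e1_gt0 : 0 < e1 by rewrite lt_min ltr01 divr_gt0.
pose M1 := 2 * M + 1; have M1_gt0 : 0 < M1 by rewrite ltr_wpDl ?mulr_ge0.
pose e2 := e / (4 * M1); have e2_gt0 : 0 < e2 by rewrite divr_gt0 ?mulr_gt0.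
(* The neighbourhoods from [kernel_near] depend on the pair of limit values; the
   finiteness of [F] and [F'] allows them to be chosen for each value separately. *)
have H (z : option X * option X) : exists AA : set (option X) * set (option X),
    [/\ near_option z.1 AA.1, near_option z.2 AA.2 &
    \forall r \near r0, forall u u', AA.1 u -> AA.2 u' ->
      `|kernel a b p r u u' - kernel a b p r0 z.1 z.2| <= e1].
  have [A [A' AP]] := kernel_near a b r0 z.1 z.2 cp e1_gt0.
  by exists (A, A').
have [AA AAP] := choice H.
pose A u := [set z | forall u', F' u' -> (AA (u, u')).1 z].
pose A' u' := [set z | forall u, F u -> (AA (u, u')).2 z].
have nA u : near_option u (A u).
  by apply: finite_near => // u' _; case: (AAP (u, u')).
have nA' u' : near_option u' (A' u').
  by apply: finite_near => // u _; case: (AAP (u, u')).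
have [B [mB muB] BP] := KP A e2 nA e2_gt0.
have [B' [mB' muB'] BP'] := KP' A' e2 nA' e2_gt0.
have near_r0 : \forall r \near r0, forall z, (F `*` F') z ->
    forall u u', (AA z).1 u -> (AA z).2 u' ->
      `|kernel a b p r u u' - kernel a b p r0 z.1 z.2| <= e1.
  have := (@finite_near _ _ (nbhs r0) (F `*` F') (fun z r => forall u u', (AA z).1 u ->
    (AA z).2 u' -> `|kernel a b p r u u' - kernel a b p r0 z.1 z.2| <= e1) _ finFF).
  by apply => z _; have [_ _] := AAP z.
have near_r : \forall w \near (y0, y0'), forall z, (F `*` F') z ->
    forall u u', (AA z).1 u -> (AA z).2 u' ->
      `|kernel a b p (m w) u u' - kernel a b p r0 z.1 z.2| <= e1 := cm near_r0.
have near_y : \forall w \near (y0, y0'), forall t, unit_itv t ->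
    (K (E w.1 t) \/ exists2 s, unit_itv s & A (E y0 s) (E w.1 t)) /\
    (~ B t -> A (E y0 t) (E w.1 t)) by exact: (cvg_fst BP).
have near_y' : \forall w \near (y0, y0'), forall t, unit_itv t ->
    (K' (E w.2 t) \/ exists2 s, unit_itv s & A' (E y0' s) (E w.2 t)) /\
    (~ B' t -> A' (E y0' t) (E w.2 t)) by exact: (cvg_snd BP').
have FF := nbhs_filter (y0, y0').
apply: (@filterS3 _ _ FF _ _ _ _ _ near_r near_y near_y') => -[y y'] kw Ey Ey'.
have EF t : unit_itv t -> exists2 u, F u & A u (E y t).
  move=> It; have [[Kt|[s Is As]] _] := Ey t It.
    by exists (E y t); [left|exact: near_option_self].
  by exists (E y0 s) => //; right; exists s.
have EF' t : unit_itv t -> exists2 u, F' u & A' u (E y' t).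
  move=> It; have [[Kt|[s Is As]] _] := Ey' t It.
    by exists (E y' t); [left|exact: near_option_self].
  by exists (E y0' s) => //; right; exists s.
rewrite !averageE -meanB//.
apply: (@le_trans _ _ (e1 + M1 * (e2 + e2))); last first.
  have : e1 <= e / 2 by rewrite ge_min lexx orbT.
  have -> : M1 * (e2 + e2) = e / 2 by rewrite /e2; field; rewrite gt_eqF.
  by lra.
apply: (@norm_mean_near_le _ _ (B `|` B')).
- exact: (simple_map_comp (fun z => z.1 - z.2)
    (simple_map_pair (simple_integrand p y0 y0') (simple_integrand p y y'))).
- exact: measurableU.
- by rewrite EFinD; apply: (le_trans (measureU2 _ mB mB')); exact: leeD.
- exact: ltW.
- exact: ltW.
- move=> t It; have [u Fu Au] := EF t It; have [u' Fu' Au'] := EF' t It.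
  have := kw (u, u') (conj Fu Fu') _ _ (Au _ Fu') (Au' _ Fu).
  have := MP (u, u') (conj Fu Fu').
  have := MP (E y0 t, E y0' t) (conj (or_intror (imageP _ It)) (or_intror (imageP _ It))).
  have : e1 <= 1 by rewrite ge_min lexx.
  rewrite /= /integrand -/r0 /M1 !ler_norml; lra.
- move=> t It /not_orP[nB nB']; rewrite distrC /integrand -/r0.
  have Ft : F (E y0 t) by right; exists t.
  have Ft' : F' (E y0' t) by right; exists t.
  by apply: (kw (_, _) (conj Ft Ft')); [apply: (Ey t It).2|apply: (Ey' t It).2].
Qed.

Lemma carrier_finite y : finite_set (carrier [set y]).
Proof.
rewrite finite_setU; split; first exact: finite_set2.
apply: (sub_finite_set _ (finite_image (fun e => odflt a e) (sE y).1)).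
by move=> x [_ [t [-> It Ex]]]; exists (Some x) => //; exists t.
Qed.

(** Near [y0] the values over [C] are in the finite set [K], where the covering
    property is applied to each of them, or close to the finitely many values
    at [y0]. *)
Lemma carrier_compact C : compact C -> compact (carrier C).
Proof.
move=> /compact_near_coveringP/near_covering_withinP cC.
apply: compactU; first by apply: finite_compact; exact: finite_set2.
apply/compact_near_coveringP => I G P FG PG.
set L := [set x | _] in PG *.
suff : \forall i \near G, C `<=` [set y | forall t x, unit_itv t ->
    E y t = Some x -> P i x].
  by apply: filterS => i CP x [y [t [Cy It Ex]]]; exact: (CP y Cy t).
apply: cC => y0 Cy0; have [_ _ _ _ locE] := rE; have [K finK KP] := locE y0.
have H x : exists NG : set X * set I, L x ->
    [/\ nbhs x NG.1, G NG.2 & forall z i, NG.1 z -> NG.2 i -> P i z].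
  have [Lx|Lx] := pselect (L x); last by exists (setT, setT).
  have [[N G'] [/= Nx GG'] NP] := PG x Lx.
  by exists (N, G') => _; split => // z i Nz Gi; exact: (NP (z, i)).
have [NG NGP] := choice H.
pose D := [set x | L x /\ (K (Some x) \/ exists2 s, unit_itv s & E y0 s = Some x)].
have finD : finite_set D.
  apply: (sub_finite_set _ (finite_image (fun e => odflt a e)
    (_ : finite_set (K `|` E y0 @` unit_itv)))).
    by move=> x [_ [Kx|[s Is Es]]]; exists (Some x) => //; [left|right; exists s].
  by rewrite finite_setU; split => //; case: (sE y0).
have near_i : \forall i \near G, forall x, D x -> (NG x).2 i.
  by apply: finite_near => // x [/NGP[]].
pose A e := if e is Some x then [set e' | exists2 z, e' = Some z & L x -> (NG x).1 z]
  else [set None].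
have nA e : near_option e (A e).
  case: e => [x|//]; rewrite /near_option /=.
  have [Lx|Lx] := pselect (L x); last by apply: filterE => z; exists z.
  by have [Nx _ _] := NGP x Lx; apply: filterS Nx => z; exists z.
have [B _ BP] := KP A 1 nA ltr01.
exists ([set y | forall t, unit_itv t ->
    K (E y t) \/ exists2 s, unit_itv s & A (E y0 s) (E y t)],
  [set i | forall x, D x -> (NG x).2 i]).
  by split => //=; apply: filterS BP => y H' t /H'[].
move=> [y i] [/= yP iP] Cy t x It Ex.
have [Kx|[s Is]] := yP t It.
  have Lx : L x by exists y, t.
  rewrite Ex in Kx; have Dx : D x by split => //; left.
  have [Nx _] := NGP x Lx; apply; last exact: iP.
  exact: nbhs_singleton.
case Es : (E y0 s) => [x'|]; rewrite Ex /A //= => -[z [<-]] Lz.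
have Lx' : L x' by exists y0, s.
have [_ _] := NGP x' Lx'; apply; first exact: Lz.
by apply: iP; split => //; right; exists s.
Qed.

(** Common core of the three continuity statements, which differ only in the sets
    on which functions are compared. *)
Lemma average_near (F : set_system (X * X -> R)) p C C' e : Filter F ->
  (\forall q \near F, forall z, (carrier C `*` carrier C') z -> `|p z - q z| <= e) ->
  \forall q \near F, forall w, (C `*` C') w -> `|average p w - average q w| <= e.
Proof.
move=> FF; apply: filterS => q pq [y y'] [/= Cy Cy'].
have -> : average p (y, y') - average q (y, y') = average ((-1) *: q + p) (y, y').
  rewrite average_linear [RHS](_ : _ = -1 * average q (y, y') + average p (y, y'))//.
  by rewrite mulN1r addrC.
apply: (average_le Cy Cy') => x x' Lx Lx'.
rewrite [X in `|X|](_ : _ = -1 * q (x, x') + p (x, x'))// mulN1r addrC.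
exact: (pq (x, x')).
Qed.

Lemma uniform_near (U : choiceType) (A : set U) (f : U -> R) e : 0 < e ->
  \forall h \near (f : {uniform` A -> R}), forall z, A z -> `|f z - h z| <= e.
Proof.
move=> e0; apply/uniform_nbhs; exists [set xy | ball xy.1 e xy.2]; split.
  exact: (entourage_ball _ (PosNum e0)).
by move=> h Eh z Az; apply: ltW; exact: Eh.
Qed.

Lemma uniform_cvg (U : choiceType) (A : set U) (F : set_system (U -> R)) f :
  Filter F ->
  (forall e, 0 < e -> \forall h \near F, forall z, A z -> `|f z - h z| <= e) ->
  {uniform A, F --> f}.
Proof.
move=> FF Ff P /uniform_nbhs[Q []]; rewrite -entourage_ballE => -[e /= e0 eQ] QP.
have e20 : 0 < e / 2 by rewrite divr_gt0.
apply: filterS (Ff _ e20) => h fh; apply: QP => z Az; apply: eQ.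
by rewrite /ball /=; apply: (le_lt_trans (fh z Az)); rewrite ltr_pdivrMr// ltr_pMr// ltr1n.
Qed.

Lemma average_continuous_ptws :
  continuous (average : {ptws (X * X)%type -> R} -> {ptws (Y * Y)%type -> R}).
Proof.
move=> p; set F := nbhs p; have FF : Filter F by exact: nbhs_filter.
have FA : Filter (average @ F) by exact: fmap_filter.
apply/(@pointwise_cvgP _ _ _ _ FA) => -[y y']; apply/cvgrPdist_le => e e0.
have := @average_near F p [set y] [set y'] e _.
move=> /(_ _) H; apply: filterS (H _) => [q /(_ (y, y'))|]; first exact.
apply: finite_near; first by apply: finite_setX; exact: carrier_finite.
move=> z _; have /pointwise_cvgP/(_ z)/cvgrPdist_le := @cvg_id _ F.
exact.
Qed.

Lemma average_continuous_uniform :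
  continuous (average : {uniform (X * X)%type -> R} -> {uniform (Y * Y)%type -> R}).
Proof.
move=> p; set F := nbhs p; have FF : Filter F by exact: nbhs_filter.
have FA : Filter (average @ F) by exact: fmap_filter.
apply: (@uniform_cvg _ _ _ _ FA) => e e0.
have near_p := @uniform_near _ setT p e e0.
apply: filterS (@average_near F p setT setT e _ _).
  by move=> q H w _; exact: H.
by apply: filterS near_p => q H w _; exact: H.
Qed.

Lemma average_continuous_compact_open :
  continuous (average : {family compact, (X * X)%type -> R} ->
                        {family compact, (Y * Y)%type -> R}).
Proof.
move=> p; set F := nbhs p; have FF : Filter F by exact: nbhs_filter.
have FA : Filter (average @ F) by exact: fmap_filter.
apply/(@fam_cvgP _ _ _ _ _ FA) => C cC; apply: (@uniform_cvg _ _ _ _ FA) => e e0.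
have cD : compact (carrier (fst @` C) `*` carrier (snd @` C)).
  by apply: compact_setX; apply: carrier_compact; apply: continuous_compact => //;
    apply: continuous_subspaceT => w; [exact: cvg_fst|exact: cvg_snd].
have near_p := fam_nbhs (p : {family compact, _ -> _})
  (entourage_ball (R : pseudoMetricType R) (PosNum e0)) cD.
apply: filterS (@average_near F p (fst @` C) (snd @` C) e _ _).
  by move=> q H w Cw; apply: H; split; exists w.
by apply: filterS near_p => q H w Dw; apply: ltW; exact: H.
Qed.

End operator.

(** * Existence of random retractions *)

(** [l n y] is the time up to which the index [n] is admissible at [y].  Where [c n] may
    fail to be locally constant the threshold is negative, and it stays so nearby. *)
Definition threshold_system (R : realType) (Y : topologicalType) (X : set Y)
    (v : Y -> R) (l : nat -> Y -> R) (c : nat -> Y -> X) :=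
  [/\ unit_valued v /\ continuous v,
      forall y, X y <-> v y = 0,
      forall y, ~ X y -> (forall n, l n @ y --> l n y) /\ exists n, 1 < l n y,
      forall y n, ~ X y -> 0 <= l n y -> \forall z \near y, c n z = c n y
    & forall (x : X) O, nbhs x O -> \forall z \near set_val x,
        forall n, ~ X z -> 0 <= l n z -> O (c n z)].

Lemma retraction_threshold_system (R : realType) (Y : topologicalType) (X : set Y)
    (f : nat -> Y -> R) (c : nat -> Y -> X) :
  retraction_system f c ->
  exists (v : Y -> R) (l : nat -> Y -> R), threshold_system v l c.
Proof.
move=> [f01 cf Xf floc fnear].
(* At a point where [f n] vanishes the threshold is [-1]; the factor [1/4] makes some
   threshold exceed [1]. *)
pose v y := wsup f y / 4; pose l n y := f n y / v y - 1.
have w01 := wsup_unit_valued f01; have cw := wsup_continuous f01 cf.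
have cv : continuous v by move=> y; apply: cvgM; [exact: cw|exact: cvg_cst].
have v0 y : X y <-> v y = 0.
  rewrite Xf -(wsup_eq0 f01) /v; split=> [->|/eqP]; first by rewrite mul0r.
  by rewrite mulf_eq0 invr_eq0 pnatr_eq0 orbF => /eqP.
have v_gt0 y : ~ X y -> 0 < v y.
  move=> /v0/eqP vy; rewrite lt_neqAle eq_sym vy /=.
  by rewrite divr_ge0//; case/andP: (w01 y).
have lf n y : ~ X y -> 0 <= l n y -> f n y != 0.
  move=> Xy; rewrite /l; have [->|//] := eqVneq (f n y) 0.
  by rewrite mul0r sub0r oppr_ge0 ler10.
exists v, l; split => //.
- by split => // y; have := w01 y; rewrite /v; lra.
- move=> y Xy; split=> [n|].
    apply: cvgB; last exact: cvg_cst.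
    by apply: cvgM; [exact: cf|apply: cvgV; [rewrite gt_eqF ?v_gt0|exact: cv]].
  have [n fn] : exists n, wsup f y / 2 < f n y / 2 ^+ n.
    by apply: (lt_wsup f01); have := v_gt0 _ Xy; rewrite /v; lra.
  exists n; rewrite /l ltrBrDr ltr_pdivlMr ?v_gt0//.
  have : f n y / 2 ^+ n <= f n y.
    have /andP[f0 _] := f01 n y.
    by rewrite ler_pdivrMr ?exprn_gt0// ler_peMr// exprn_ege1// ler1n.
  by rewrite /v; lra.
- by move=> y n Xy /(lf n y Xy); exact: floc.
- move=> x O /fnear; apply: filterS => z fz n Xz lz.
  exact/fz/lf.
Qed.

Section existence.
Context (R : realType) (Y : topologicalType) (X : set Y).
Context (v : Y -> R) (l : nat -> Y -> R) (c : nat -> Y -> X).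
Hypothesis vlc : threshold_system v l c.
Hypothesis closedX : closed X.

Let v01 y : 0 <= v y <= 1. Proof. by case: vlc => -[]. Qed.
Let cv : continuous v. Proof. by case: vlc => -[]. Qed.
Let Xv y : X y <-> v y = 0. Proof. by case: vlc. Qed.
Let cl y n : ~ X y -> l n @ y --> l n y.
Proof. by case: vlc => _ _ + _ _ => /[apply] -[]. Qed.
Let l1 y : ~ X y -> exists n, 1 < l n y.
Proof. by case: vlc => _ _ + _ _ => /[apply] -[]. Qed.
Let cloc y n : ~ X y -> 0 <= l n y -> \forall z \near y, c n z = c n y.
Proof. by case: vlc => _ _ _ + _; apply. Qed.
Let cnear (x : X) O : nbhs x O -> \forall z \near set_val x,
  forall n, ~ X z -> 0 <= l n z -> O (c n z).
Proof. by case: vlc => _ _ _ _; apply. Qed.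

Let v_gt0 y : ~ X y -> 0 < v y.
Proof. by move=> /Xv/eqP vy; rewrite lt_neqAle eq_sym vy; case/andP: (v01 y). Qed.

(** The default [0] occurs only at times beyond all thresholds. *)
Definition first_above y t : nat :=
  xget 0 [set n | t < l n y /\ forall i, (i < n)%N -> l i y <= t].

Lemma first_aboveP y t n : t < l n y ->
  [/\ t < l (first_above y t) y, (first_above y t <= n)%N
    & forall i, (i < first_above y t)%N -> l i y <= t].
Proof.
move=> tn; have exP : exists n, t < l n y by exists n.
rewrite /first_above; case: xgetP => [k _ [tk kmin]|/(_ (ex_minn exP))].
  by split => //; rewrite leqNgt; apply/negP => /kmin; rewrite leNgt tn.
case: ex_minnP => k tk kmin []; split => // i ik.
by rewrite leNgt; apply/negP => /kmin; rewrite leqNgt ik.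
Qed.

Lemma first_above_unique y t n : t < l n y ->
  (forall i, (i < n)%N -> l i y <= t) -> first_above y t = n.
Proof.
move=> tn nmin; have [tf fn _] := first_aboveP tn.
apply/eqP; rewrite eqn_leq fn leqNgt; apply/negP => /nmin.
by rewrite leNgt tf.
Qed.

Definition rretract (y : Y) (t : R) : option X :=
  if pselect (X y) is left Xy then Some (SigSub (mem_set Xy))
  else if t < 1 - v y then Some (c (first_above y t) y) else None.

Lemma rretract_in (x : X) t : rretract (set_val x) t = Some x.
Proof.
rewrite /rretract; case: pselect => [Xx|]; last by case; exact: set_valP.
by congr Some; apply/val_inj.
Qed.

Lemma rretract_out y t : ~ X y ->
  rretract y t = if t < 1 - v y then Some (c (first_above y t) y) else None.
Proof. by rewrite /rretract; case: pselect. Qed.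

(** One index is admissible at all times, so finitely many indices are used, each on a
    set of times obtained from finitely many intervals. *)
Lemma rretract_simple y : simple_map (rretract y).
Proof.
have [Xy|Xy] := pselect (X y).
  rewrite (_ : rretract y = fun=> Some (SigSub (mem_set Xy))); first exact: simple_map_cst.
  by apply/funext => t; rewrite (rretract_in (SigSub (mem_set Xy))).
have [N lN] := l1 Xy.
have lt1 t : unit_itv t -> t < l N y.
  by rewrite /unit_itv /= in_itv /= => /andP[_ t1]; exact: le_lt_trans lN.
split.
  apply: (@sub_finite_set _ _ ([set None] `|` (fun n => Some (c n y)) @` `I_N.+1)).
    move=> _ [t It <-]; rewrite rretract_out//; case: ifP => _; last by left.
    right; exists (first_above y t) => //=; rewrite ltnS.
    by have [] := first_aboveP (lt1 _ It).
  by rewrite finite_setU; split; [exact: finite_set1|apply: finite_image; exact: finite_II].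
move=> B.
pose below r : set R := `]-oo, r[%classic.
have mbelow r : measurable (below r) by exact: measurable_itv.
pose first n := below (l n y) `\` \bigcup_(i in `I_n) below (l i y).
have mfirst n : measurable (first n).
  by apply: measurableD => //; apply: bigcup_measurable.
rewrite (_ : _ `&` _ = unit_itv `&`
    ((~` below (1 - v y) `&` [set _ | B None]) `|`
     (below (1 - v y) `&` \bigcup_(n in [set n | B (Some (c n y))]) first n))).
  apply: measurableI; first exact: measurable_unit_itv.
  apply: measurableU.
    have [BN|BN] := pselect (B None).
      rewrite (_ : [set _ | _] = setT) ?setIT; first exact: measurableC.
      by apply/seteqP; split.
    rewrite (_ : [set _ | _] = set0) ?setI0//.
    by apply/seteqP; split.
  by apply: measurableI => //; apply: bigcup_measurable => n _; exact: mfirst.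
apply/seteqP; split=> t [It].
  rewrite /= rretract_out//; case: ifPn => [tv Bt|tv Bt]; split => //.
    right; split; first by rewrite /below /= in_itv.
    have [t1 _ tmin] := first_aboveP (lt1 _ It).
    exists (first_above y t) => //; split; first by rewrite /below /= in_itv.
    by move=> [i /= /tmin]; rewrite /below /= in_itv /= leNgt => /negP.
  by left; split => //; rewrite /below /= in_itv /=; apply/negP.
move=> [[nbelow BN]|[tv [n /= Bn [tn tmin]]]]; split => //=; rewrite rretract_out//.
  by case: ifPn => // tv; case: nbelow; rewrite /below /= in_itv.
move: tv; rewrite /below /= in_itv /= => ->.
rewrite (@first_above_unique _ _ n) => // i ik; rewrite leNgt; apply/negP => ti.
by apply: tmin; exists i => //; rewrite /below /= in_itv.
Qed.

Lemma rretract_end y : exists2 d, 0 < d <= 1 &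
  forall t, 1 - d <= t <= 1 -> rretract y t = rretract y 1.
Proof.
have [Xy|Xy] := pselect (X y).
  exists 1; first by rewrite ltr01 lexx.
  by move=> t _; rewrite !(rretract_in (SigSub (mem_set Xy))).
exists (v y); first by rewrite v_gt0//; case/andP: (v01 y).
move=> t /andP[tv _]; rewrite !rretract_out// ltNge tv /=.
by rewrite ltrBrDr -subr_gt0 opprD addNKr oppr_gt0 ltNge; case/andP: (v01 y) => ->.
Qed.

Lemma rretract_none y : ~ X y -> rretract y 1 = None.
Proof.
by move=> Xy; rewrite rretract_out// ltrBrDr gtrDl ltNge; case/andP: (v01 y) => ->.
Qed.

Let thickening n (h : nat -> R) (d : R) : set R :=
  \big[setU/set0]_(i < n) `[h i - d, h i + d]%classic.

Let measure_thickening n h d : 0 < d ->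
  (lebesgue_measure (thickening n h d) <= (n%:R * (2 * d))%:E)%E.
Proof.
move=> d0; have mh i : (i < n)%N -> measurable (`[h i - d, h i + d]%classic : set R).
  by move=> _; exact: measurable_itv.
apply: (le_trans (Boole_inequality (@lebesgue_measure R) mh)).
rewrite (eq_bigr (fun=> (2 * d)%:E)) => [|i _].
  by rewrite sumEFin big_const_ord iter_addr_0 -[_ *+ n]mulr_natl.
rewrite [LHS]lebesgue_measure_itv /= lte_fin ifT; last lra.
by rewrite -EFinB; congr EFin; lra.
Qed.

(** At a point of [X] the exceptional times are those of the final interval, where the
    value is new.  Outside [X] the value is determined by finitely many thresholds
    that vary continuously, so off their neighbourhoods it does not change at all. *)
Lemma rretract_local y0 : exists2 K : set (option X), finite_set K &
  forall A (e : R), (forall z, near_option z (A z)) -> 0 < e ->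
  exists2 B, measurable B /\ (lebesgue_measure B <= e%:E)%E &
  \forall y \near y0, forall t, unit_itv t ->
    (K (rretract y t) \/ exists2 s, unit_itv s & A (rretract y0 s) (rretract y t)) /\
    (~ B t -> A (rretract y0 t) (rretract y t)).
Proof.
have [Xy0|Xy0] := pselect (X y0).
  exists [set None]; first exact: finite_set1.
  move=> A e nA e0; pose x := SigSub (mem_set Xy0) : X.
  have Ex t : rretract y0 t = Some x by exact: (rretract_in x).
  exists (`[1 - e, 1]%classic).
    split; first exact: measurable_itv.
    rewrite lebesgue_measure_itv /= lte_fin ltrBlDr ltrDl e0.
    by rewrite -EFinB lee_fin; lra.
  have [W [oW Wx] WA] := nbhs_set_type (nA (Some x)).
  have nW : \forall y \near y0, W y by exact: open_nbhs_nbhs.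
  have nv : \forall y \near y0, v y < e.
    by apply: (cvgr_lt _ (@cv y0)); rewrite (Xv y0).1.
  have nc := cnear (nA (Some x)).
  apply: (@filterS3 _ _ (nbhs_filter y0) _ _ _ _ _ nW nv nc) => y Wy vy cy t It.
  rewrite Ex; have [Xy|Xy] := pselect (X y).
    have AE : A (Some x) (rretract y t).
      by rewrite (rretract_in (SigSub (mem_set Xy))); exact: WA.
    by split => //; right; exists t => //; rewrite Ex.
  rewrite rretract_out//; case: ifPn => tv.
    have [n ln] := l1 Xy; move: It; rewrite /unit_itv /= in_itv /= => /andP[t0 t1].
    have [tl _ _] := first_aboveP (le_lt_trans t1 ln).
    have AE := cy (first_above y t) Xy (le_trans t0 (ltW tl)).
    by split => //; right; exists t; rewrite ?Ex// /unit_itv /= in_itv /= t0.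
  split; first by left.
  move: It; rewrite /unit_itv /= !in_itv /= -leNgt in tv * => /andP[t0 t1].
  by case; rewrite t1 andbT; lra.
have [N lN] := l1 Xy0.
exists ([set None] `|` (fun n => Some (c n y0)) @` `I_N.+1).
  by rewrite finite_setU; split; [exact: finite_set1|apply: finite_image; exact: finite_II].
move=> A e nA e0.
(* The times at which the value at [y0] may jump; the last one is the beginning of the
   final interval. *)
pose h i := if (i <= N)%N then l i y0 else 1 - v y0.
pose d := e / (N.+2%:R * 2); have d0 : 0 < d by rewrite divr_gt0// mulr_gt0// ltr0n.
exists (thickening N.+2 h d).
  split; first by apply: bigsetU_measurable => i _; exact: measurable_itv.
  apply: (le_trans (measure_thickening _ _ d0)); rewrite lee_fin /d.
  have : (N.+2%:R : R) != 0 by rewrite pnatr_eq0.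
  by move: N.+2%:R => M M0; rewrite le_eqVlt; apply/orP; left; apply/eqP; field.
have n1 : \forall y \near y0, ~ X y.
  by apply: open_nbhs_nbhs; split => //; exact: closed_openC.
have n2 : \forall y \near y0, 1 < l N y by exact: (cvgr_gt _ (@cl y0 N Xy0) _ lN).
have n3 : \forall y \near y0, forall i : 'I_N.+1, `|l i y0 - l i y| < d.
  by apply: filter_forall => i; move/cvgrPdist_lt: (@cl y0 i Xy0); exact.
have n4 : \forall y \near y0, `|v y0 - v y| < d.
  by move/cvgrPdist_lt: (@cv y0); exact.
have n5 : \forall y \near y0, forall i : 'I_N.+1, 0 <= l i y -> c i y = c i y0.
  apply: filter_forall => i; have [li|li] := leP 0 (l i y0).
    by apply: filterS (cloc Xy0 li) => y.
  have : \forall y \near y0, l i y < 0 by exact: (cvgr_lt _ (@cl y0 i Xy0) _ li).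
  by apply: filterS => y; rewrite ltNge => /negP.
near=> y.
have Xy : ~ X y by near: y.
have lNy : 1 < l N y by near: y.
have ly : forall i : 'I_N.+1, `|l i y0 - l i y| < d by near: y.
have vy : `|v y0 - v y| < d by near: y.
have cy : forall i : 'I_N.+1, 0 <= l i y -> c i y = c i y0 by near: y.
move=> t It; have /andP[t0 t1] : 0 <= t <= 1 by move: It; rewrite /unit_itv /= in_itv.
have [tk kN kmin] := first_aboveP (le_lt_trans t1 lNy).
set k := first_above y t in tk kN kmin.
have ckE : c k y = c k y0.
  by apply: (cy (Ordinal (kN : (k < N.+1)%N))); exact: le_trans t0 (ltW tk).
split.
  left; rewrite rretract_out//; case: ifP => _; last by left.
  by right; exists k => //=; rewrite ckE.
move=> nB.
have side i (u : R) : (i < N.+2)%N -> `|h i - u| < d -> (t < u) = (t < h i).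
  move=> iN; rewrite ltr_distl => /andP[u1 u2].
  have /negP : ~ (h i - d <= t <= h i + d).
    move=> th; apply: nB; rewrite /thickening (bigD1 (Ordinal iN))//=.
    by left; rewrite /= in_itv.
  rewrite negb_and -!ltNge => /orP[th|th].
    by rewrite (_ : t < h i); [rewrite (_ : t < u)//; lra|lra].
  by apply/idP/idP => ?; lra.
have sidel i : (i <= N)%N -> (t < l i y) = (t < l i y0).
  move=> iN; have := @side i (l i y) _; rewrite /h iN; apply; first exact: leqW.
  exact: (ly (Ordinal (iN : (i < N.+1)%N))).
have sidev : (t < 1 - v y) = (t < 1 - v y0).
  have := @side N.+1 (1 - v y) (ltnSn _); rewrite /h ltnn; apply.
  by rewrite (_ : _ - _ = - (v y0 - v y)) ?normrN//; ring.
have kE : first_above y0 t = k.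
  apply: first_above_unique; first by rewrite -sidel.
  move=> i ik; rewrite leNgt -sidel; first by rewrite -leNgt; exact: kmin.
  by apply: leq_trans kN; exact: ltnW.
suff -> : rretract y t = rretract y0 t by exact: near_option_self.
by rewrite !rretract_out// sidev kE -/k ckE.
Unshelve. all: by end_near. Qed.

Lemma rretract_random_retraction : random_retraction rretract.
Proof.
split.
- exact: rretract_simple.
- exact: rretract_in.
- exact: rretract_end.
- exact: rretract_none.
- exact: rretract_local.
Qed.

End existence.

Theorem theorem1 (R : realType) (Y : topologicalType) (X : set Y)
    (stratY : stratifiable Y) (closedX : closed X)
    (card_X : exists x y : Y, [/\ X x, X y & x <> y]) :
  exists T : {linear (X * X -> R) -> (Y * Y -> R)},
    [/\ positive_operator T,
        extension_operator T,
        [/\ preserves_constants T,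
            preserves bounded_fun bounded_fun T,
            preserves (fun p : X * X -> R => continuous p)
                      (fun q : Y * Y -> R => continuous q) T,
            preserves (@is_pseudometric R X) (@is_pseudometric R Y) T
          & preserves (@is_metric R X) (@is_metric R Y) T]
      & [/\ continuous (T : {ptws (X * X)%type -> R} -> {ptws (Y * Y)%type -> R}),
            continuous (T : {uniform (X * X)%type -> R} ->
                            {uniform (Y * Y)%type -> R})
          & continuous (T : {family compact, (X * X)%type -> R} ->
                            {family compact, (Y * Y)%type -> R})]].
Proof.
have [a0 [b0 [Xa Xb ab]]] := card_X.
pose a := SigSub (mem_set Xa) : X; pose b := SigSub (mem_set Xb) : X.
have {}ab : a <> b by case.
have T1Y : accessible_space Y by case: stratY.
have [S stratS] := stratifiable_stratification stratY.
have [m [m01 cm mm]] := stratified_continuous_metric R T1Y stratS.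
have [f [c fc]] := stratified_retraction_system R T1Y stratS closedX a.
have [v [l vlc]] := retraction_threshold_system fc.
have rE := rretract_random_retraction vlc closedX.
set E := rretract _ _ _ in rE.
pose linT := GRing.isLinear.Build R (X * X -> R) (Y * Y -> R) *:%R (average a b m E)
  (average_linear a b m rE).
pose T : {linear (X * X -> R) -> (Y * Y -> R)} := HB.pack (average a b m E) linT.
exists T; split.
- exact: average_positive.
- exact: average_extension.
- split.
  + exact: average_cst.
  + exact: average_bounded.
  + exact: average_continuous.
  + exact: average_pseudometric.
  + exact: average_metric.
- split.
  + exact: average_continuous_ptws.
  + exact: average_continuous_uniform.
  + exact: average_continuous_compact_open.
Qed.
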